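(* (a) For every fixed integer $r\ge 1$ there is a sequence of integers $i_r=i_r(n)$ with $i_r=(1+o(1))\frac{2^r}{2^r+1}n$ as $n\to\infty$ such that $$La(n,P_3,\bigwedge\nolimits_r)=La(n,P_3,\bigvee\nolimits_r)=\binom{n}{i_r}\binom{\binom{i_r}{\lfloor i_r/2\rfloor}}{r}.$$ (b) For every fixed integer $r\ge 1$ there are sequences of integers $i_r=i_r(n)$ and $j_r=j_r(n)$ with $i_r=(1+o(1))\frac{n}{2^r+2}$ as $n\to\infty$ and, for each $n$, either $j_r=n-i_r$ or $j_r=n-i_r-1$, such that $$La(n,P_4,D_r)=\binom{n}{j_r}\binom{j_r}{i_r}\binom{\binom{j_r-i_r}{\lfloor (j_r-i_r)/2\rfloor}}{r}.$$ (c) As $n\to\infty$, $$2^{(c+o(1))n}\le La(n,P_3,N)\le o(2^{3n}),$$ where $c=h(c_0)+3c_0\,h\!\left(\frac{1-c_0}{c_0}\right)=2.9502\ldots$ and $c_0$ is the real root of the equation $0=7x^3-10x^2+5x-1$.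
   Context: $[n]=\{1,\dots,n\}$, and $2^{[n]}$ is the family of all subsets of $[n]$. For a finite poset $P$ and a family $\mathcal{F}$ of sets, a subfamily $\mathcal{G}\subseteq\mathcal{F}$ is a copy of $P$ in $\mathcal{F}$ if there is a bijection $\phi:P\to\mathcal{G}$ such that $x\le_P x'$ implies $\phi(x)\subseteq\phi(x')$ (the converse implication is not required). $c(P,\mathcal{F})$ denotes the number of copies of $P$ in $\mathcal{F}$ (i.e. the number of such subfamilies $\mathcal{G}$). For posets $P,Q$, $La(n,P,Q)=\max\{c(Q,\mathcal{F}):\mathcal{F}\subseteq 2^{[n]},\ c(P,\mathcal{F})=0\}$. Posets: $P_k$ is the chain on $k$ elements. $\bigvee_r$ has $r+1$ elements $0,a_1,\dots,a_r$ with relations $0\le a_i$ for all $i$; $\bigwedge_r$ has $r+1$ elements $a_1,\dots,a_r,1$ with relations $a_i\le 1$ for all $i$. The generalized diamond $D_r$ has $r+2$ elements $a,b_1,\dots,b_r,c$ with $a<b_1,\dots,b_r<c$. The poset $N$ has four elements $a,b,c,d$ with relations $a\le c$, $b\le c$, $b\le d$. $h(x)=-x\log_2 x-(1-x)\log_2(1-x)$ is the binary entropy function. Binomial coefficients $\binom{a}{b}$ with $b<0$ or $b>a\ge 0$ are $0$. *)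

(* Defs.v *)
From HB Require Import structures.
From mathcomp Require Import all_boot all_order all_algebra.
From mathcomp Require Import all_classical all_reals all_analysis.
Set Implicit Arguments.
Unset Strict Implicit.
Unset Printing Implicit Defensive.
Import Order.TTheory GRing.Theory Num.Theory.

Local Open Scope nat_scope.

Section Copies.
Variables (d : Order.disp_t) (P : finPOrderType d) (T : finType).

(* Weak (not necessarily induced) copies: phi need not reflect the order. *)
Definition is_copy (G : {set {set T}}) : bool :=
  [exists phi : {ffun P -> {set T}},
    [&& injectiveb phi, [set phi x | x : P] == G
      & [forall x : P, forall y : P, (x <= y)%O ==> (phi x \subset phi y)]]].

Definition copies (F : {set {set T}}) : nat :=
  #|[set G : {set {set T}} | (G \subset F) && is_copy G]|.

End Copies.

Definition La (n : nat) d (P : finPOrderType d) d' (Q : finPOrderType d') : nat :=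
  \max_(F : {set {set 'I_n}} | copies P F == 0) copies Q F.

Definition chain (k : nat) : finPOrderType _ := 'I_k.

(* [None] is the least element 0, [Some i] are the a_i. *)
Definition vee (r : nat) : Type := option 'I_r.
HB.instance Definition _ r := Finite.on (vee r).

Section Vee.
Variable r : nat.
Definition vee_le (x y : vee r) : bool := (x == y) || (x == None).
Fact vee_le_refl : reflexive vee_le.
Proof. by move=> x; rewrite /vee_le eqxx. Qed.
Fact vee_le_anti : antisymmetric vee_le.
Proof. by move=> [i|] [j|] //= /andP[]; rewrite /vee_le !orbF => /eqP. Qed.
Fact vee_le_trans : transitive vee_le.
Proof.
by move=> [j|] [i|] [k|] //; rewrite /vee_le ?orbT ?orbF // => /eqP->.
Qed.
End Vee.

Fact vee_display : Order.disp_t. Proof. exact: Order.Disp tt tt. Qed.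
HB.instance Definition _ r := Order.Le_isPOrder.Build vee_display (vee r)
  (@vee_le_refl r) (@vee_le_anti r) (@vee_le_trans r).

(* [Some i] are the a_i, [None] is the greatest element 1. *)
Definition wedge (r : nat) : Type := option 'I_r.
HB.instance Definition _ r := Finite.on (wedge r).

Section Wedge.
Variable r : nat.
Definition wedge_le (x y : wedge r) : bool := (x == y) || (y == None).
Fact wedge_le_refl : reflexive wedge_le.
Proof. by move=> x; rewrite /wedge_le eqxx. Qed.
Fact wedge_le_anti : antisymmetric wedge_le.
Proof. by move=> [i|] [j|] //= /andP[]; rewrite /wedge_le !orbF => /eqP. Qed.
Fact wedge_le_trans : transitive wedge_le.
Proof.
by move=> [j|] [i|] [k|] //; rewrite /wedge_le ?orbT ?orbF // => /eqP->.
Qed.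
End Wedge.

Fact wedge_display : Order.disp_t. Proof. exact: Order.Disp tt tt. Qed.
HB.instance Definition _ r := Order.Le_isPOrder.Build wedge_display (wedge r)
  (@wedge_le_refl r) (@wedge_le_anti r) (@wedge_le_trans r).

(* [inr false] is a, [inl i] are the b_i, [inr true] is c. *)
Definition diamond (r : nat) : Type := ('I_r + bool)%type.
HB.instance Definition _ r := Finite.on (diamond r).

Section Diamond.
Variable r : nat.
Definition diamond_le (x y : diamond r) : bool :=
  [|| x == y, x == inr false | y == inr true].
Fact diamond_le_refl : reflexive diamond_le.
Proof. by move=> x; rewrite /diamond_le eqxx. Qed.
Fact diamond_le_anti : antisymmetric diamond_le.
Proof.
by move=> [i|[]] [j|[]] //= /andP[]; rewrite /diamond_le /= ?orbF // => /eqP.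
Qed.
Fact diamond_le_trans : transitive diamond_le.
Proof.
move=> [j|[]] [i|[]] [k|[]] //; rewrite /diamond_le ?eqxx ?orbT ?orbF //.
by move=> /eqP->.
Qed.
End Diamond.

Fact diamond_display : Order.disp_t. Proof. exact: Order.Disp tt tt. Qed.
HB.instance Definition _ r :=
  Order.Le_isPOrder.Build diamond_display (diamond r)
  (@diamond_le_refl r) (@diamond_le_anti r) (@diamond_le_trans r).

(* 0, 1, 2, 3 stand for a, b, c, d. *)
Definition posetN : Type := 'I_4.
HB.instance Definition _ := Finite.on posetN.

Definition posetN_le (x y : posetN) : bool :=
  (x == y) ||
  ((nat_of_ord x, nat_of_ord y) \in [:: (0, 2); (1, 2); (1, 3)]).
Fact posetN_le_refl : reflexive posetN_le.
Proof. by move=> x; rewrite /posetN_le eqxx. Qed.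
Fact posetN_le_anti : antisymmetric posetN_le.
Proof.
by move=> [[|[|[|[|x]]]] px] [[|[|[|[|y]]]] py] //= _; apply/val_inj.
Qed.
Fact posetN_le_trans : transitive posetN_le.
Proof.
by move=> [[|[|[|[|y]]]] py] [[|[|[|[|x]]]] px] [[|[|[|[|z]]]] pz].
Qed.

Fact posetN_display : Order.disp_t. Proof. exact: Order.Disp tt tt. Qed.
HB.instance Definition _ := Order.Le_isPOrder.Build posetN_display posetN
  posetN_le_refl posetN_le_anti posetN_le_trans.

(* Integer-argument binomial coefficient, zero when b < 0 or b > a >= 0.
   It is also set to 0 for a < 0 <= b. *)
Definition binz (a b : int) : nat :=
  match a, b with
  | Posz m, Posz k => 'C(m, k)
  | _, _ => 0
  end.

Local Open Scope ring_scope.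

Definition log2 {R : realType} (x : R) : R := ln x / ln 2.

Definition entropy {R : realType} (x : R) : R :=
  - x * log2 x - (1 - x) * log2 (1 - x).

(* Main.v *)
(* A weak copy of a wedge, vee or diamond is determined by its extreme members
   and the r-subset of sets between them, so copies are counted by sums of
   binomials over members, or over comparable pairs.  In a chain-free family the
   extreme members form antichains, and so do the sets between them.  The LYM
   inequality, iterated once for pairs, then bounds each sum by its largest value
   over choices of levels, and full levels attain it.  Ratios of consecutive
   candidate values locate the optimal levels.

   For the poset N, with a < c the sizes of the two middle sets, the same
   inequality reduces the upper bound to 'C(n, c) 'C(c, a) 2^c 2^(n - a) <= 8^n,
   with an extra factor tending to 0 because central binomial coefficients
   'C(m, m/2) are o(2^m).  The lower bound takes the two full levels m ~ c_0 n and
   n - m; by Stirling the exponent is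
   F(x) = 2x ln x - 4(1-x) ln(1-x) - 3(2x-1) ln(2x-1) at x = m/n.  The critical
   point of F is the root c_0 of the cubic, where F collapses to
   ln(c_0/(1-c_0)^2). *)
Require Import Defs.
From HB Require Import structures.
From mathcomp Require Import all_boot all_order all_algebra.
From mathcomp Require Import all_classical all_reals all_analysis.
From mathcomp Require Import fintype finset zify ring lra.
Import Order.TTheory GRing.Theory Num.Theory.
Import numFieldNormedType.Exports.

Set Implicit Arguments.
Unset Strict Implicit.
Unset Printing Implicit Defensive.

Local Open Scope nat_scope.

(** * The LYM inequality and central binomials *)

Definition central (n : nat) : nat := 'C(n, n./2).

(** Below the middle the ratio of neighbouring binomials is at least 1, so stepping down from [n./2]
    only decreases them, and the upper half follows by symmetry. Truncated subtraction makes the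
    induction stationary once it reaches 0. *)
Lemma leq_central n m : 'C(n, m) <= central n.
Proof.
have below k : 'C(n, n./2 - k) <= central n.
  elim: k => [|k IH]; first by rewrite subn0.
  apply: leq_trans IH; case: (leqP n./2 k) => [le|lt].
    by have -> : n./2 - k.+1 = n./2 - k by lia.
  have -> : n./2 - k = (n./2 - k.+1).+1 by lia.
  have := mul_bin_left n (n./2 - k.+1); set j := n./2 - k.+1 => e.
  have le : j.+1 <= n - j by rewrite /j; lia.
  by rewrite -(leq_pmul2l (ltn0Sn j)) e leq_mul2r le orbT.
case: (ltnP n m) => [lt|le]; first by rewrite bin_small.
case: (leqP m n./2) => [le2|lt2]; first by rewrite -(subKn le2) below.
rewrite -bin_sub //.
have -> : n - m = n./2 - (n./2 - (n - m)) by lia.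
exact: below.
Qed.

Lemma central_gt0 n : 0 < central n.
Proof. by rewrite bin_gt0; lia. Qed.

(** By symmetry the entry at [n./2.+1] of row [n.+1] is central too, so one diagonal step links
    consecutive central binomials. This recurrence drives both the size estimate and the growth
    ratio of [central]. *)
Lemma central_S n : (n./2).+1 * central n.+1 = n.+1 * central n.
Proof.
have -> : central n.+1 = 'C(n.+1, n./2.+1).
  rewrite /central -(bin_sub (n := n.+1) (m := n./2.+1)); last lia.
  by congr binomial; lia.
by rewrite -mul_bin_diag.
Qed.

Section Antichains.
Variable T : finType.
Implicit Types (A B C : {set T}) (F G : {set {set T}}).

Definition antichain F := {in F &, forall A B, A \subset B -> A = B}.

(* Induction on [C]: if [C] is not a member, every member misses some point of
   [C], and the members missing [x] form an antichain inside [C :\ x]. *)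
Lemma lym F C :
  antichain F -> {in F, forall A, A \subset C} ->
  \sum_(A in F) (#|A|)`! * (#|C| - #|A|)`! <= (#|C|)`!.
Proof.
move: {2}#|C| (erefl #|C|) => n.
elim: n C F => [|n IH] C F cC anti subC.
  have C0 : C = set0 by apply/cards0_eq.
  have sF : F \subset [set C].
    apply/subsetP => A /subC; rewrite C0 subset0 => /eqP ->.
    by rewrite inE.
  rewrite (leq_trans (_ : _ <= \sum_(A in [set C]) (#|A|)`! * (#|C| - #|A|)`!)) //.
    rewrite [leqRHS](big_setID F) /= (setIidPr sF); exact: leq_addr.
  by rewrite big_set1 subnn muln1.
case: (boolP (C \in F)) => [CF|CnF].
  have -> : F = [set C].
    apply/setP => A; rewrite inE; apply/idP/eqP => [AF|-> //].
    by apply: anti => //; exact: subC.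
  by rewrite big_set1 subnn muln1.
(* A proper subset [A] of [C] misses [#|C| - #|A|] points of [C]. Peeling that factor off the
   factorial turns the summand into a sum of [g A] over the missed points, and the two sums can be
   exchanged. *)
pose g A := (#|A|)`! * (n - #|A|)`!.
have -> : \sum_(A in F) (#|A|)`! * (#|C| - #|A|)`!
        = \sum_(A in F) \sum_(x in C | x \notin A) g A.
  apply: eq_bigr => A AF.
  have pr : A \proper C.
    rewrite properEneq subC // andbT; apply: contraNneq CnF => <-; exact: AF.
  rewrite sum_nat_cond_const /g.
  have -> : [set x in C | x \notin A] = C :\: A.
    by apply/setP => x; rewrite !inE andbC.
  rewrite cardsDS ?(proper_sub pr) //.
  have lt := proper_card pr.
  have -> : #|C| - #|A| = (n - #|A|).+1 by lia.
  by rewrite factS; lia.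
under eq_bigr do rewrite big_mkcondr /=.
rewrite exchange_big /=.
have bound x : x \in C -> \sum_(A in F) (if x \notin A then g A else 0) <= n`!.
  move=> xC; rewrite -big_mkcondr /=.
  have cx : #|C :\ x| = n by move: (cardsD1 x C); rewrite xC cC; lia.
  have := IH (C :\ x) [set A in F | x \notin A] cx.
  rewrite cx => H; apply: leq_trans (H _ _).
  - by apply: eq_leq; apply: eq_bigl => A; rewrite inE.
  - by move=> A B; rewrite !inE => /andP[? _] /andP[? _]; exact: anti.
  - move=> A; rewrite inE => /andP[AF xA]; rewrite subsetD1 xA andbT; exact: subC.
apply: (@leq_trans (\sum_(x in C) n`!)); first exact: leq_sum.
by rewrite sum_nat_const cC factS.
Qed.

(** Each [w A] is at most [M] divided by the binomial of its level, and the inverse binomials over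
    an antichain sum to at most 1. Factorials keep the argument in the natural numbers. *)
Lemma lym_weight F C (w : {set T} -> nat) M :
  antichain F -> {in F, forall A, A \subset C} ->
  {in F, forall A, w A * 'C(#|C|, #|A|) <= M} -> \sum_(A in F) w A <= M.
Proof.
move=> anti subC wM; rewrite -(leq_pmul2r (fact_gt0 #|C|)) big_distrl /=.
apply: leq_trans (leq_mul (leqnn M) (lym anti subC)).
rewrite big_distrr /=; apply: leq_sum => A AF.
rewrite -(bin_fact (subset_leq_card (subC A AF))) mulnA leq_mul //.
exact: wM.
Qed.

(** Removing [A] embeds the interval from [A] to [C] into the subsets of [C :\: A] and preserves
    incomparability; weight 1 in the LYM bound then gives Sperner's theorem. *)
Lemma sperner_interval F A C :
  antichain F -> {in F, forall B, A \subset B /\ B \subset C} ->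
  #|F| <= central (#|C| - #|A|).
Proof.
move=> anti sub; case: (set_0Vmem F) => [->|[B0 /sub[AB0 B0C]]].
  by rewrite cards0.
have AC := subset_trans AB0 B0C.
have addA B : A \subset B -> A :|: B :\: A = B.
  move=> AB; apply/setP => x; rewrite !inE.
  by case: (boolP (x \in A)) => //= /(subsetP AB) ->.
have inj : {in F &, injective (fun B => B :\: A)}.
  by move=> B B' /sub[? _] /sub[? _] e; rewrite -(addA B) // e addA.
rewrite -(card_in_imset inj) -cardsDS // -sum1_card.
apply: (lym_weight (C := C :\: A)).
- move=> _ _ /imsetP[B BF ->] /imsetP[B' BF' ->] s; congr (_ :\: _).
  apply: anti => //; have [? _] := sub _ BF; have [? _] := sub _ BF'.
  by rewrite -(addA B) // -(addA B') // setUS.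
- by move=> _ /imsetP[B /sub[_ ?] ->]; exact: setSD.
- by move=> B _; rewrite mul1n leq_central.
Qed.

End Antichains.

(** * Counting weak copies *)

Section CountCopies.
Variable T : finType.
Implicit Types (A B C : {set T}) (F G S : {set {set T}}).

Definition below F C := [set A in F | A \proper C].
Definition above F A := [set C in F | A \proper C].
Definition between F A C := [set B in F | (A \proper B) && (B \proper C)].

Lemma is_copyP d (P : finPOrderType d) G :
  reflect (exists phi : P -> {set T},
     [/\ injective phi, [set phi x | x : P] = G
       & forall x y : P, (x <= y)%O -> phi x \subset phi y])
    (is_copy P G).
Proof.
apply: (iffP existsP) => [[phi /and3P[/injectiveP inj /eqP im /forallP mono]]|].
  exists phi; split=> // x y xy; exact: (implyP (forallP (mono x) y)).
case=> phi [inj im mono]; exists (finfun phi); apply/and3P; split.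
- by apply/injectiveP => x y; rewrite !ffunE => /inj.
- by apply/eqP; rewrite -im; apply: eq_imset => x; rewrite ffunE.
- by apply/forallP => x; apply/forallP => y; apply/implyP => /mono; rewrite !ffunE.
Qed.

Lemma copies_gt0 d (P : finPOrderType d) F G :
  G \subset F -> is_copy P G -> 0 < copies P F.
Proof. by move=> GF cG; apply/card_gt0P; exists G; rewrite inE GF. Qed.

Lemma chain_copy k (s : seq {set T}) F :
  size s = k -> sorted (fun A B => A \proper B) s -> {subset s <= F} ->
  0 < copies (chain k) F.
Proof.
move=> sk sor sF; pose phi (i : 'I_k) := nth set0 s i.
have mono (i j : 'I_k) : i < j -> phi i \proper phi j.
  move=> ij; apply: (sorted_ltn_nth _ _ sor) => //.
  - by move=> ? ? ?; exact: proper_trans.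
  - by rewrite inE sk.
  - by rewrite inE sk.
apply: (@copies_gt0 _ _ _ [set phi i | i : 'I_k]).
  apply/subsetP => _ /imsetP[i _ ->]; apply: sF; apply: mem_nth.
  by rewrite sk.
apply/is_copyP; exists phi; split=> //.
- move=> i j e; apply/val_inj; case: (ltngtP i j) => // /mono; rewrite e.
    by rewrite (properxx (phi j)).
  by rewrite (properxx (phi j)).
- move=> i j; rewrite leEord leq_eqVlt => /orP[/eqP/val_inj->//|/mono].
  exact: proper_sub.
Qed.

(** Cardinality strictly increases along a strict chain, so a chain meets each level at most
    once. *)
Lemma chain_free_levels k (L : seq nat) F :
  {in F, forall A, #|A| \in L} -> size L < k -> copies (chain k) F = 0.
Proof.
move=> FL; apply: contraTeq; rewrite -lt0n => /card_gt0P[G].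
rewrite inE => /andP[GF /is_copyP[phi [inj im mono]]]; rewrite -leqNgt.
have mono_lt (i j : chain k) : (i < j)%N -> #|phi i| < #|phi j|.
  move=> ij; apply: proper_card; rewrite properEneq mono ?leEord 1?ltnW // andbT.
  by apply: contraTneq ij => /inj ->; rewrite ltnn.
have := @uniq_leq_size _ [seq #|phi i| | i : chain k] L.
rewrite size_image card_ord; apply.
  rewrite map_inj_uniq ?enum_uniq // => i j e; apply/val_inj.
  by case: (ltngtP i j) => // /mono_lt; rewrite e ltnn.
move=> _ /imageP[i _ ->]; apply: FL; apply: (subsetP GF).
by rewrite -im imset_f.
Qed.

Lemma card_enum_fun S r : #|S| = r ->
  exists2 e : 'I_r -> {set T}, injective e & S = [set e i | i : 'I_r].
Proof.
move=> <-; exists (@enum_val _ (mem S)); first exact: enum_val_inj.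
apply/setP => A; apply/idP/imsetP => [AS|[i _ ->]]; last exact: enum_valP.
by exists (enum_rank_in AS A); rewrite ?enum_rankK_in.
Qed.

(** A copy corresponds to exactly one pair of a top [C] and an [r]-set of members below it. The top
    is recovered from the union, since two distinct candidates would be proper subsets of each
    other. *)
Lemma copies_wedge r F :
  copies (wedge r) F = \sum_(C in F) 'C(#|below F C|, r).
Proof.
pose X := [set p : {set T} * {set {set T}} |
  (p.1 \in F) && ((p.2 \subset below F p.1) && (#|p.2| == r))].
have XE p : p \in X -> [/\ p.1 \in F, {in p.2, forall A, A \in F /\ A \proper p.1}
     & #|p.2| = r].
  rewrite inE => /and3P[pF /subsetP sub /eqP pr]; split=> // A /sub.
  by rewrite inE => /andP[].
have -> : \sum_(C in F) 'C(#|below F C|, r) = #|X|.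
  rewrite -sum1_card; under eq_bigr do rewrite -cards_draws -sum1_card.
  rewrite pair_big_dep /=; apply: eq_bigl => p; rewrite !inE //.
have -> : copies (wedge r) F = #|[set p.1 |: p.2 | p in X]|.
  apply: eq_card => G; rewrite inE.
  apply/andP/imsetP => [[GF /is_copyP[phi [inj im mono]]]|[[C S] /XE[/= CF SC Sr]->]].
    have inF x : phi x \in F by apply: (subsetP GF); rewrite -im imset_f.
    exists (phi None, [set phi (Some i) | i : 'I_r]).
      rewrite inE /= inF card_imset ?card_ord ?eqxx ?andbT //; last first.
        by move=> i j /inj[].
      apply/subsetP => _ /imsetP[i _ ->]; rewrite inE inF /= properEneq.
      rewrite mono ?andbT /=; last by [].
      by apply: contra_eq_neq (erefl (phi None)) => /inj.
    rewrite -im /=; apply/setP => A; rewrite !inE; apply/imsetP/orP => /=.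
      by case=> -[i|] _ ->; [right; apply: imset_f | left].
    by case=> [/eqP->|/imsetP[i _ ->]]; [exists None | exists (Some i)].
  split.
    by apply/subsetP => A; rewrite !inE => /orP[/eqP->//|/SC[]].
  have [e inj eS] := card_enum_fun Sr.
  have eC i : e i \proper C by have [] := SC (e i); rewrite // eS imset_f.
  apply/is_copyP; exists (fun o : wedge r => if o is Some i then e i else C); split.
  - move=> [i|] [j|] //; first by move/inj->.
      by move=> h; have := eC i; rewrite h properxx.
    by move=> h; have := eC j; rewrite h properxx.
  - apply/setP => A; rewrite !inE eS; apply/imsetP/orP.
      by case=> -[i|] _ ->; [right; apply: imset_f | left].
    by case=> [/eqP->|/imsetP[i _ ->]]; [exists None | exists (Some i)].
  - move=> [i|] [j|] //; last by move=> _; exact: proper_sub.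
    by rewrite /Order.le /= /wedge_le orbF => /eqP[->].
rewrite card_in_imset // => -[C S] [C' S'] /XE[/= _ SC _] /XE[/= _ SC' _] e.
have eC : C = C'.
  have h : C \in C' |: S' by rewrite -e !inE eqxx.
  have h' : C' \in C |: S by rewrite e !inE eqxx.
  move: h h'; rewrite !inE => /orP[/eqP//|/SC'[_ lt]] /orP[/eqP//|/SC[_ lt']].
  by have := proper_trans lt lt'; rewrite properxx.
subst C'; congr pair; rewrite -(setU1K (a := C) (B := S)); last first.
  by apply/negP => /SC[_]; rewrite properxx.
rewrite e setU1K //; by apply/negP => /SC'[_]; rewrite properxx.
Qed.

(** As for wedges, with triples: the bottom and the top are recovered from a copy as its least and
    greatest members, and what is left is the middle [r]-set. *)
Lemma copies_diamond r F : 0 < r ->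
  copies (diamond r) F = \sum_(C in F) \sum_(A in below F C) 'C(#|between F A C|, r).
Proof.
move=> r0.
pose X := [set p : {set T} * {set T} * {set {set T}} |
  ((p.1.1 \in F) && (p.1.2 \in below F p.1.1)) &&
  ((p.2 \subset between F p.1.2 p.1.1) && (#|p.2| == r))].
have XE p : p \in X -> [/\ p.1.1 \in F, p.1.2 \in F,
    p.1.2 \proper p.1.1,
    {in p.2, forall B, [/\ B \in F, p.1.2 \proper B & B \proper p.1.1]}
    & #|p.2| = r].
  rewrite inE => /andP[/andP[pF]]; rewrite inE => /andP[p2F pr].
  case/andP=> /subsetP sub /eqP pr'; split=> // B /sub.
  by rewrite inE => /and3P[].
have -> : \sum_(C in F) \sum_(A in below F C) 'C(#|between F A C|, r) = #|X|.
  rewrite -sum1_card pair_big_dep /=.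
  under eq_bigr do rewrite -cards_draws -sum1_card.
  rewrite pair_big_dep /=; apply: eq_bigl => -[[C A] S]; rewrite !inE //.
have -> : copies (diamond r) F = #|[set p.1.1 |: (p.1.2 |: p.2) | p in X]|.
  apply: eq_card => G; rewrite inE.
  apply/andP/imsetP => [[GF /is_copyP[phi [inj im mono]]]|
                        [[[C A] S] /XE[/= CF AF AC SC Sr]->]].
    have inF x : phi x \in F by apply: (subsetP GF); rewrite -im imset_f.
    have pr x y : (x <= y)%O -> x != y -> phi x \proper phi y.
      by move=> xy ne; rewrite properEneq mono // andbT (inj_eq inj).
    exists (phi (inr true), phi (inr false), [set phi (inl i) | i : 'I_r]).
      rewrite !inE /= !inF pr // card_imset ?card_ord ?eqxx ?andbT //; last first.
        by move=> i j /inj[].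
      by apply/subsetP => _ /imsetP[i _ ->]; rewrite inE inF !pr.
    rewrite -im /=; apply/setP => B; rewrite !inE; apply/imsetP/or3P => /=.
      case=> -[i|[]] _ ->.
      - by apply: Or33; apply: imset_f.
      - by apply: Or31.
      - by apply: Or32.
    by case=> [/eqP->|/eqP->|/imsetP[i _ ->]];
      [exists (inr true) | exists (inr false) | exists (inl i)].
  split.
    by apply/subsetP => B; rewrite !inE => /or3P[/eqP->//|/eqP->//|/SC[]].
  have [e inj eS] := card_enum_fun Sr.
  have eC i : e i \proper C by have [] := SC (e i); rewrite // eS imset_f.
  have eA i : A \proper e i by have [] := SC (e i); rewrite // eS imset_f.
  have neq (B B' : {set T}) : B \proper B' -> B <> B'.
    by move=> pr h; move: pr; rewrite h properxx.
  apply/is_copyP; exists (fun o : diamond r =>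
    match o with inl i => e i | inr b => if b then C else A end); split.
  - move=> [i|[]] [j|[]] //=; first by move/inj->.
    + by move/neq: (eC i).
    + by move/esym; move/neq: (eA i).
    + by move/esym; move/neq: (eC j).
    + by move/esym; move/neq: AC.
    + by move/neq: (eA j).
    + by move/neq: AC.
  - apply/setP => B; rewrite !inE eS; apply/imsetP/or3P.
      case=> -[i|[]] _ ->.
      - by apply: Or33; apply: imset_f.
      - by apply: Or31.
      - by apply: Or32.
    by case=> [/eqP->|/eqP->|/imsetP[i _ ->]];
      [exists (inr true) | exists (inr false) | exists (inl i)].
  - move=> [i|[]] [j|[]] // h; first last.
    1,2,3: exact: proper_sub.
    by move: h; rewrite /Order.le /= /diamond_le /= !orbF => /eqP[->].
have notS C A S : A \proper C ->
    {in S, forall B, [/\ B \in F, A \proper B & B \proper C]} ->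
    (A \notin S) /\ (C \notin A |: S).
  move=> AC SC; split; first by apply/negP => /SC[_]; rewrite properxx.
  rewrite !inE negb_or; apply/andP; split.
    by apply: contraTneq AC => ->; rewrite properxx.
  by apply/negP => /SC[_ _]; rewrite properxx.
rewrite card_in_imset // => -[[C A] S] [[C' A'] S'].
move=> /XE[/= _ _ AC SC _] /XE[/= _ _ AC' SC' _] e.
have sub B : B \in C |: (A |: S) -> A \subset B /\ B \subset C.
  rewrite !inE => /or3P[/eqP->|/eqP->|/SC[_ ? ?]]; split=> //; exact: proper_sub.
have sub' B : B \in C' |: (A' |: S') -> A' \subset B /\ B \subset C'.
  rewrite !inE => /or3P[/eqP->|/eqP->|/SC'[_ ? ?]]; split=> //; exact: proper_sub.
have eC : C = C'.
  apply/eqP; rewrite eqEsubset; apply/andP; split.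
    by have [] := sub' C; rewrite -?e // !inE eqxx.
  by have [] := sub C'; rewrite ?e // !inE eqxx.
have eA : A = A'.
  apply/eqP; rewrite eqEsubset; apply/andP; split.
    by have [] := sub A'; rewrite ?e // !inE eqxx orbT.
  by have [] := sub' A; rewrite -?e // !inE eqxx orbT.
subst C' A'; congr pair.
have [nA nC] := notS _ _ _ AC SC; have [nA' nC'] := notS _ _ _ AC' SC'.
by rewrite -(setU1K nA) -(setU1K nC) e setU1K // setU1K.
Qed.

(** The components are [((c, b), (a, d))]. Grouping by the middle relation [b < c] makes the choices
    of [a] below [c] and [d] above [b] independent. Coincidences such as [a = b] or [c = d] are
    allowed. *)
Definition N_quads F := [set q : ({set T} * {set T}) * ({set T} * {set T}) |
  (q.1.1 \in F) && (q.1.2 \in below F q.1.1) &&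
  ((q.2.1 \in below F q.1.1) && (q.2.2 \in above F q.1.2))].

Definition quad_set (q : ({set T} * {set T}) * ({set T} * {set T})) :=
  [set q.2.1; q.1.2; q.1.1; q.2.2].

(** Every copy is the image of some quadruple. Only an inequality holds, as a set of four members
    may carry several such labellings. *)
Lemma copies_N_le F : copies posetN F <= #|N_quads F|.
Proof.
apply: leq_trans (leq_imset_card quad_set _); apply: subset_leq_card.
apply/subsetP => G; rewrite inE => /andP[GF /is_copyP[phi [inj im mono]]].
pose p k : posetN := @inord 3 k.
have inF x : phi x \in F by apply: (subsetP GF); rewrite -im imset_f.
have pr i j : i < 4 -> j < 4 -> (i, j) \in [:: (0, 2); (1, 2); (1, 3)] ->
    phi (p i) \proper phi (p j).
  move=> i4 j4 ij; rewrite properEneq mono; last first.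
    by rewrite /Order.le /= /posetN_le !inordK // ij orbT.
  rewrite andbT (inj_eq inj); apply/eqP => /(congr1 val) /=.
  by rewrite !inordK // => e; move: ij; rewrite e !inE !xpair_eqE; lia.
apply/imsetP; exists ((phi (p 2), phi (p 1)), (phi (p 0), phi (p 3))).
  by rewrite !inE /= !inF !pr.
rewrite -im; apply/setP => A; rewrite !inE; apply/imsetP/idP => [[i _ ->]|].
  have -> : i = p i by rewrite /p inord_val.
  by case: i => -[|[|[|[|i]]]] //= lt; rewrite eqxx ?orbT.
by rewrite -!orbA => /or4P[]/eqP->; eexists.
Qed.

(** A quadruple with distinct entries does span a copy, and a given copy has four members from which
    the four entries are drawn, hence at most [4 ^ 4] preimages. *)
Lemma N_quads_le F :
  #|[set q in N_quads F | uniq [:: q.2.1; q.1.2; q.1.1; q.2.2]]|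
    <= 4 ^ 4 * copies posetN F.
Proof.
set X := [set q in _ | _].
have fiber G : #|[set q in X | quad_set q == G]| <= #|G| ^ 4.
  have -> : #|G| ^ 4 = #|setX (setX G G) (setX G G)| by rewrite !cardsX; lia.
  apply: subset_leq_card; apply/subsetP => -[[a b] [c d]].
  rewrite inE => /andP[_ /eqP <-]; rewrite !inE /= !eqxx ?orbT //.
rewrite -sum1_card (partition_big quad_set
  (mem [set G : {set {set T}} | (G \subset F) && is_copy posetN G])) /=.
  rewrite mulnC /copies -sum_nat_const; apply: leq_sum => G.
  rewrite inE => /andP[_ /is_copyP[phi [inj im _]]].
  rewrite sum1dep_card; apply: leq_trans (fiber G) _.
  by rewrite -im card_imset // card_ord.
move=> [[c b] [a d]]; rewrite inE => /andP[+ un]; rewrite inE /= => /andP[/andP[cF +] /andP[+ +]].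
rewrite !inE => /andP[bF bc] /andP[aF ac] /andP[dF bd].
apply/andP; split.
  by apply/subsetP => x; rewrite !inE -!orbA => /or4P[]/eqP->.
pose phi (i : posetN) := nth set0 [:: a; b; c; d] i.
apply/is_copyP; exists phi; split.
- by move=> i j /eqP; rewrite /phi nth_uniq // => /eqP/val_inj.
- apply/setP => A; rewrite !inE -!orbA; apply/imsetP/or4P => [[i _ ->]|].
    by case: i => -[|[|[|[|i]]]] //= lt; rewrite /phi /= eqxx;
      [apply: Or41 | apply: Or42 | apply: Or43 | apply: Or44].
  by case=> /eqP->; [exists (@inord 3 0) | exists (@inord 3 1)
    | exists (@inord 3 2) | exists (@inord 3 3)] => //; rewrite /phi inordK.
- move=> i j; rewrite /Order.le /= /posetN_le => /orP[/eqP->//|].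
  by rewrite !inE !xpair_eqE => /or3P[]/andP[/eqP ei /eqP ej];
    rewrite /phi ei ej; exact: proper_sub.
Qed.

Lemma card_N_quads F : #|N_quads F|
  = \sum_(C in F) \sum_(B in below F C) #|below F C| * #|above F B|.
Proof.
rewrite pair_big_dep /= -sum1_card.
under [RHS]eq_bigr do rewrite -cardsX -sum1_card.
by rewrite pair_big_dep /=; apply: eq_bigl => q; rewrite !inE.
Qed.

(** Complementation reverses inclusion, so it carries copies of a poset to copies of its dual; [f]
    and [g] are mutually inverse order-reversing maps. *)
Lemma copies_compl d (P : finPOrderType d) d' (Q : finPOrderType d')
    (f : P -> Q) (g : Q -> P) F :
  cancel f g -> cancel g f -> (forall x y, (x <= y)%O = (f y <= f x)%O) ->
  copies P F = copies Q [set ~: A | A in F].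
Proof.
move=> fK gK anti.
have iC : injective (fun A : {set T} => ~: A) by exact: setC_inj.
have KC (G : {set {set T}}) : [set ~: A | A in [set ~: A | A in G]] = G.
  rewrite -imset_comp -[RHS]imset_id; apply: eq_imset => A /=; exact: setCK.
rewrite /copies; set X := [set G | _].
pose compl G := [set ~: A | A in G].
have ci : injective compl := can_inj (KC : cancel compl compl).
rewrite -(card_imset (mem X) ci).
apply: eq_card => G.
apply/imsetP/idP => [[H]|]; rewrite /X inE => /andP[HF /is_copyP[phi [inj im mono]]].
  move=> ->; rewrite inE imsetS //=; apply/is_copyP.
  exists (fun y => ~: phi (g y)); split.
  - by move=> x y /iC/inj/(can_inj gK).
  - rewrite /compl -im -imset_comp; apply/setP => A.
    apply/imsetP/imsetP => -[x _ ->]; first by exists (g x).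
    by exists (f x); rewrite /= ?fK.
  - by move=> x y xy; rewrite setCS; apply: mono; rewrite anti !gK.
exists [set ~: A | A in G]; last by rewrite /compl KC.
rewrite /X inE -[F]KC imsetS //=; apply/is_copyP.
exists (fun x => ~: phi (f x)); split.
- by move=> x y /iC/inj/(can_inj fK).
- rewrite /compl -im -imset_comp; apply/setP => A.
  apply/imsetP/imsetP => -[x _ ->]; first by exists (f x).
  by exists (g x); rewrite /= ?gK.
- by move=> x y; rewrite anti setCS; exact: mono.
Qed.

End CountCopies.

(** * Extremal numbers as maxima over levels *)

Section ExtremalBounds.
Variable T : finType.
Implicit Types (A B C D : {set T}) (F G : {set {set T}}).

Lemma antichainI F :
  (forall A B, A \in F -> B \in F -> A \proper B -> False) -> antichain F.
Proof.
move=> noF A B AF BF AB; apply/eqP; apply: contra_notT (noF A B AF BF) => ne.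
by rewrite properEneq ne.
Qed.

Section NoChain3.
Variable F : {set {set T}}.
Hypothesis F3 : copies (chain 3) F = 0.

Lemma no_chain3 A B C : A \in F -> B \in F -> C \in F ->
  A \proper B -> B \proper C -> False.
Proof.
move=> AF BF CF AB BC.
suff : 0 < copies (chain 3) F by rewrite F3.
apply: (@chain_copy _ _ [:: A; B; C]) => //=; first by rewrite AB BC.
by move=> X; rewrite !inE => /or3P[]/eqP->.
Qed.

Lemma antichain_below C : C \in F -> antichain (below F C).
Proof.
move=> CF; apply: antichainI => A B; rewrite !inE => /andP[AF _] /andP[BF BC] AB.
exact: no_chain3 AB BC.
Qed.

Lemma antichain_above A : A \in F -> antichain (above F A).
Proof.
move=> AF; apply: antichainI => B C; rewrite !inE => /andP[BF AB] /andP[CF _] BC.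
exact: no_chain3 AB BC.
Qed.

(** A member with something below it cannot lie below another member, as that would complete a
    3-chain. *)
Lemma antichain_uppers : antichain [set C in F | below F C != set0].
Proof.
apply: antichainI => B C; rewrite !inE => /andP[BF /set0Pn[A +]] /andP[CF _].
by rewrite inE => /andP[AF AB]; exact: no_chain3 AB.
Qed.

Lemma card_below_le C : C \in F -> #|below F C| <= central #|C|.
Proof.
move=> CF; rewrite -[#|C|]subn0 -(cards0 T).
apply: sperner_interval; first exact: antichain_below.
by move=> A; rewrite inE sub0set => /andP[_ /proper_sub].
Qed.

Lemma card_above_le A : A \in F -> #|above F A| <= central (#|T| - #|A|).
Proof.
move=> AF; rewrite -cardsT; apply: sperner_interval; first exact: antichain_above.
by move=> C; rewrite inE subsetT => /andP[_ /proper_sub].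
Qed.

End NoChain3.

(** The inner sum over [L C], scaled by the binomial of the level of [C], is bounded by LYM inside
    [C]; this is exactly the hypothesis of LYM for the outer sum. *)
Lemma pair_lym (U : {set {set T}}) (L : {set T} -> {set {set T}})
    (w : {set T} -> {set T} -> nat) M :
  antichain U ->
  {in U, forall C, antichain (L C)} ->
  {in U, forall C, {in L C, forall A, A \subset C}} ->
  {in U, forall C, {in L C, forall A,
     w A C * 'C(#|T|, #|C|) * 'C(#|C|, #|A|) <= M}} ->
  \sum_(C in U) \sum_(A in L C) w A C <= M.
Proof.
move=> aU aL sub wM; apply: (@lym_weight _ U setT) => // C CU.
rewrite cardsT big_distrl /=.
by apply: (@lym_weight _ (L C) C) => //; [exact: aL | exact: sub | exact: wM].
Qed.

(** Since [r] is positive, members with nothing below them contribute 0. The remaining ones form an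
    antichain, and the sets below each of them are counted by Sperner's bound. *)
Lemma wedge_bound F r M : copies (chain 3) F = 0 -> 0 < r ->
  (forall k, 0 < k <= #|T| -> 'C(#|T|, k) * 'C(central k, r) <= M) ->
  \sum_(C in F) 'C(#|below F C|, r) <= M.
Proof.
move=> F3 r0 le.
rewrite (bigID (fun C => below F C == set0)) /= big1 ?add0n; last first.
  by move=> C /andP[_ /eqP->]; rewrite cards0 bin0n eqn0Ngt r0.
rewrite (eq_bigl (fun C => C \in [set C in F | below F C != set0])); last first.
  by move=> C; rewrite !inE.
apply: (@lym_weight _ _ setT) => //; first exact: antichain_uppers.
move=> C; rewrite inE cardsT => /andP[CF /set0Pn[A]]; rewrite inE => /andP[_ AC].
rewrite mulnC; apply: leq_trans (le #|C| _); last first.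
  by rewrite max_card andbT (leq_ltn_trans _ (proper_card AC)).
by rewrite leq_mul2l leq_bin2l ?orbT // card_below_le.
Qed.

Lemma no_chain4 F A B C D : copies (chain 4) F = 0 ->
  A \in F -> B \in F -> C \in F -> D \in F ->
  A \proper B -> B \proper C -> C \proper D -> False.
Proof.
move=> F4 AF BF CF DF AB BC CD.
suff : 0 < copies (chain 4) F by rewrite F4.
apply: (@chain_copy _ _ [:: A; B; C; D]) => //=; first by rewrite AB BC CD.
by move=> X; rewrite !inE => /or4P[]/eqP->.
Qed.

Lemma diamond_bound F r M : copies (chain 4) F = 0 -> 0 < r ->
  (forall a c, a.+1 < c <= #|T| ->
     'C(#|T|, c) * 'C(c, a) * 'C(central (c - a), r) <= M) ->
  \sum_(C in F) \sum_(A in below F C) 'C(#|between F A C|, r) <= M.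
Proof.
move=> F4 r0 le.
(* Only pairs with a member strictly between them contribute. With this restriction the tops, the
   bottoms under a fixed top, and the sets between are all antichains, since a comparability would
   extend to a 4-chain. *)
pose L C := [set A in below F C | between F A C != set0].
have -> : \sum_(C in F) \sum_(A in below F C) 'C(#|between F A C|, r) =
          \sum_(C in [set C in F | L C != set0]) \sum_(A in L C) 'C(#|between F A C|, r).
  have inner C : \sum_(A in below F C) 'C(#|between F A C|, r) =
                 \sum_(A in L C) 'C(#|between F A C|, r).
    rewrite (bigID (fun A => between F A C == set0)) /= big1 ?add0n; last first.
      by move=> A /andP[_ /eqP->]; rewrite cards0 bin0n eqn0Ngt r0.
    by apply: eq_bigl => A; rewrite !inE.
  rewrite (bigID (fun C => L C == set0)) /= big1 ?add0n; last first.
    by move=> C /andP[_ /eqP e]; rewrite inner e big_set0.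
  by apply: eq_big => C; [rewrite !inE | rewrite inner].
have LP C A : A \in L C ->
    exists2 B, [/\ A \in F, A \proper C & B \in F] & A \proper B /\ B \proper C.
  rewrite !inE => /andP[/andP[AF AC] /set0Pn[B]]; rewrite inE => /and3P[? ? ?].
  by exists B.
apply: pair_lym.
- apply: antichainI => C C'; rewrite !inE => /andP[CF /set0Pn[A /LP +]] /andP[CF' _].
  by case=> B [AF _ BF] [AB BC] CC'; exact: (no_chain4 F4 _ _ _ _ AB BC CC').
- move=> C; rewrite inE => /andP[CF _]; apply: antichainI => A A'.
  move=> /LP[_ [AF _ _] _] /LP[B [AF' _ BF] [AB BC]] AA'.
  exact: (no_chain4 F4 _ _ _ _ AA' AB BC).
- by move=> C _ A /LP[B [_ /proper_sub AC _] _].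
move=> C; rewrite inE => /andP[CF _] A /LP[B [AF AC BF] [AB BC]].
have /proper_card ltA := AB; have /proper_card ltC := BC.
rewrite -mulnA mulnC; apply: leq_trans (le #|A| #|C| _); last first.
  by rewrite max_card andbT; lia.
rewrite leq_mul2l leq_bin2l ?orbT //; apply: sperner_interval.
  apply: antichainI => B1 B2; rewrite !inE => /and3P[? ? _] /and3P[? _ ?] ?.
  by apply: (@no_chain4 F A B1 B2 C).
by move=> B'; rewrite inE => /and3P[_ /proper_sub ? /proper_sub].
Qed.

Lemma N_bound F M : copies (chain 3) F = 0 ->
  (forall a c, a < c <= #|T| ->
     'C(#|T|, c) * 'C(c, a) * (central c * central (#|T| - a)) <= M) ->
  copies posetN F <= M.
Proof.
move=> F3 le; apply: leq_trans (copies_N_le F) _; rewrite card_N_quads.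
rewrite (bigID (fun C => below F C == set0)) /= big1 ?add0n; last first.
  by move=> C /andP[_ /eqP->]; rewrite big_set0.
rewrite (eq_bigl (fun C => C \in [set C in F | below F C != set0])); last first.
  by move=> C; rewrite !inE.
apply: pair_lym; first exact: antichain_uppers.
- by move=> C; rewrite inE => /andP[CF _]; exact: antichain_below.
- by move=> C _ A; rewrite inE => /andP[_ /proper_sub].
move=> C; rewrite inE => /andP[CF _] A; rewrite inE => /andP[AF AC].
rewrite -mulnA mulnC; apply: leq_trans (le #|A| #|C| _); last first.
  by rewrite max_card andbT proper_card.
by rewrite leq_mul2l leq_mul ?orbT // ?card_below_le // card_above_le.
Qed.

(** The sets in the interval are obtained injectively by adding to [A] a subset of [C :\: A] of size
    [b - #|A|]. *)
Lemma card_interval_ge A C b : A \subset C -> #|A| <= b ->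
  'C(#|C| - #|A|, b - #|A|)
    <= #|[set B : {set T} | [&& A \subset B, B \subset C & #|B| == b]]|.
Proof.
move=> AC Ab; rewrite -cardsDS // -cards_draws.
set X := [set D : {set T} | _].
have XP D : D \in X -> [/\ D \subset C, [disjoint A & D] & #|D| = b - #|A|].
  by rewrite inE subsetD disjoint_sym => /andP[/andP[? ?] /eqP].
rewrite -(@card_in_imset _ _ (fun D => A :|: D) (mem X)); last first.
  move=> D D' /XP[_ dD _] /XP[_ dD' _] /= e.
  have KD (E : {set T}) : [disjoint A & E] -> E = (A :|: E) :\: A.
    rewrite disjoint_sym => dE; apply/setP => x; rewrite !inE.
    case: (boolP (x \in A)) => //= xA; apply/negP => xE.
    by have := disjointFr dE xE; rewrite xA.
  by rewrite (KD D) // e -KD.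
apply: subset_leq_card; apply/subsetP => _ /imsetP[D /XP[DC dD Dc] ->].
rewrite inE subsetUl subUset AC DC /= cardsU disjoint_setI0 // cards0 Dc; lia.
Qed.

Definition levels (L : seq nat) : {set {set T}} := [set A : {set T} | #|A| \in L].

Lemma levels_free k L : size L < k -> copies (chain k) (levels L) = 0.
Proof. by move=> sL; apply: (chain_free_levels (L := L)) => // A; rewrite inE. Qed.

Lemma levels_below_ge L (C : {set T}) k : k \in L -> k < #|C| ->
  'C(#|C|, k) <= #|below (levels L) C|.
Proof.
move=> kL kC; rewrite -cards_draws; apply: subset_leq_card.
apply/subsetP => A; rewrite !inE => /andP[AC /eqP Ak]; rewrite Ak kL.
by rewrite properEcard AC Ak.
Qed.

Lemma levels_above_ge L (A : {set T}) m : m \in L -> #|A| < m ->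
  'C(#|T| - #|A|, m - #|A|) <= #|above (levels L) A|.
Proof.
move=> mL mA; rewrite -cardsT.
apply: leq_trans (card_interval_ge (subsetT A) (ltnW mA)) _.
apply: subset_leq_card; apply/subsetP => B; rewrite !inE => /and3P[AB _ /eqP Bm].
by rewrite Bm mL properEcard AB Bm.
Qed.

Lemma levels_between_ge L (A C : {set T}) b : b \in L -> A \subset C -> #|A| < b < #|C| ->
  'C(#|C| - #|A|, b - #|A|) <= #|between (levels L) A C|.
Proof.
move=> bL sAC /andP[Ab bC]; apply: leq_trans (card_interval_ge sAC (ltnW Ab)) _.
apply: subset_leq_card; apply/subsetP => B; rewrite !inE => /and3P[AB BC /eqP Bb].
by rewrite Bb bL !properEcard AB BC Bb Ab.
Qed.

Lemma sum_level_ge F k (g : {set T} -> nat) M :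
  {in [set C : {set T} | #|C| == k], forall C, C \in F /\ M <= g C} ->
  'C(#|T|, k) * M <= \sum_(C in F) g C.
Proof.
move=> H.
have -> : 'C(#|T|, k) = #|[set C : {set T} | #|C| == k]|.
  by rewrite -cardsT -cards_draws; apply: eq_card => C; rewrite !inE subsetT.
rewrite -sum_nat_const.
apply: (@leq_trans (\sum_(C in [set C : {set T} | #|C| == k]) g C)).
  by apply: leq_sum => C /H[].
rewrite big_mkcond [leqRHS]big_mkcond; apply: leq_sum => C _.
by case: ifP => // /H[-> _].
Qed.

Lemma levels_wedge_ge k r : 0 < k ->
  'C(#|T|, k) * 'C(central k, r) <= copies (wedge r) (levels [:: k; k./2]).
Proof.
move=> k0; rewrite copies_wedge; apply: sum_level_ge => C; rewrite inE => /eqP Ck.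
split; first by rewrite !inE Ck eqxx.
apply: leq_bin2l; rewrite -Ck /central; apply: levels_below_ge; last by rewrite Ck; lia.
by rewrite !inE Ck eqxx orbT.
Qed.

Lemma levels_diamond_ge a d r : 1 < d -> 0 < r ->
  'C(#|T|, a + d) * 'C(a + d, a) * 'C(central d, r)
    <= copies (diamond r) (levels [:: a; a + d./2; a + d]).
Proof.
move=> d1 r0; rewrite copies_diamond // -mulnA; apply: sum_level_ge => C.
rewrite inE => /eqP Ck; split; first by rewrite !inE Ck eqxx !orbT.
rewrite -{1}Ck -cards_draws -sum_nat_const.
rewrite big_mkcond [leqRHS]big_mkcond; apply: leq_sum => A _.
rewrite inE; case: ifP => // /andP[AC /eqP Aa].
rewrite !inE properEcard AC Aa Ck eqxx /= ifT; last lia.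
apply: leq_bin2l.
have := @levels_between_ge [:: a; a + d./2; a + d] A C (a + d./2).
rewrite Aa Ck !addKn; apply=> //; last lia.
by rewrite !inE eqxx orbT.
Qed.

End ExtremalBounds.

Lemma La_le n d (P : finPOrderType d) d' (Q : finPOrderType d') M :
  (forall F : {set {set 'I_n}}, copies P F = 0 -> copies Q F <= M) -> La n P Q <= M.
Proof. by move=> H; apply/bigmax_leqP => F /eqP; exact: H. Qed.

Lemma La_ge n d (P : finPOrderType d) d' (Q : finPOrderType d') (F : {set {set 'I_n}}) :
  copies P F = 0 -> copies Q F <= La n P Q.
Proof. by move=> F0; apply: leq_bigmax_cond; rewrite F0. Qed.

(** Complementing a family swaps vees with wedges and keeps 3-chains, because the chain is self-dual
    through [rev_ord]. *)
Lemma La_vee n r : La n (chain 3) (vee r) = La n (chain 3) (wedge r).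
Proof.
have chainC (F : {set {set 'I_n}}) :
    copies (chain 3) F = copies (chain 3) [set ~: A | A in F].
  apply: (copies_compl _ (@rev_ordK 3) (@rev_ordK 3)) => x y.
  by rewrite !leEord /=; have := ltn_ord x; have := ltn_ord y; lia.
have veeC (F : {set {set 'I_n}}) :
    copies (vee r) F = copies (wedge r) [set ~: A | A in F].
  apply: (@copies_compl _ _ (vee r) _ (wedge r) (fun x => x) (fun x => x)) => //.
  by move=> x y; rewrite /Order.le /= /vee_le /wedge_le eq_sym.
have wedgeC (F : {set {set 'I_n}}) :
    copies (wedge r) F = copies (vee r) [set ~: A | A in F].
  apply: (@copies_compl _ _ (wedge r) _ (vee r) (fun x => x) (fun x => x)) => //.
  by move=> x y; rewrite /Order.le /= /vee_le /wedge_le eq_sym.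
apply/eqP; rewrite eqn_leq; apply/andP; split; apply: La_le => F F0.
  by rewrite veeC La_ge // -chainC.
by rewrite wedgeC La_ge // -chainC.
Qed.

Lemma La_wedge n r : 0 < r ->
  La n (chain 3) (wedge r) = \max_(k < n.+1 | 0 < k) 'C(n, k) * 'C(central k, r).
Proof.
move=> r0; apply/eqP; rewrite eqn_leq; apply/andP; split.
  apply: La_le => F F3; rewrite copies_wedge; apply: wedge_bound => // k.
  rewrite card_ord => /andP[k0 kn].
  by apply: (leq_bigmax_cond (Ordinal (kn : k < n.+1))).
apply/bigmax_leqP => k k0; rewrite -{1}[n]card_ord.
apply: leq_trans (levels_wedge_ge _ _ k0) _; apply: La_ge.
exact: levels_free.
Qed.

(** Both sides are the multinomial coefficient with parts [a], [c - a], [n - c]. Choosing the gap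
    [c - a] first isolates the dependence on [a] in a single binomial, which can then be maximized
    alone. *)
Lemma trinomial n c a : a <= c <= n ->
  'C(n, c) * 'C(c, a) = 'C(n, c - a) * 'C(n - (c - a), a).
Proof.
move=> /andP[ac cn]; have [dn rn] : c - a <= n /\ a <= n - (c - a) by lia.
have := bin_fact cn; have := bin_fact ac; have := bin_fact dn; have := bin_fact rn.
have -> : n - (c - a) - a = n - c by lia.
have := fact_gt0 a; have := fact_gt0 (c - a); have := fact_gt0 (n - c).
set x := 'C(n, c); set y := 'C(c, a); set z := 'C(n, _); set t := 'C(_, a).
set f1 := a`!; set f2 := (c - a)`!; set f3 := (n - c)`! => p3 p2 p1 e1 e2 e3 e4.
have e : x * y * (f1 * f2 * f3) = z * t * (f1 * f2 * f3).
  by transitivity n`!; [rewrite -e4 -e3 | rewrite -e2 -e1]; lia.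
apply/eqP; rewrite -(eqn_pmul2r (_ : 0 < f1 * f2 * f3)) ?e //.
by rewrite !muln_gt0 p1 p2.
Qed.

(** For a fixed gap [d] between the outer levels the best bottom level is the middle of [n - d], so
    only the maximization over [d] remains. *)
Lemma La_diamond n r : 0 < r ->
  La n (chain 4) (diamond r)
    = \max_(d < n.+1 | 1 < d) 'C(n, d) * central (n - d) * 'C(central d, r).
Proof.
move=> r0; apply/eqP; rewrite eqn_leq; apply/andP; split.
  apply: La_le => F F4; rewrite copies_diamond //; apply: diamond_bound => // a c.
  rewrite card_ord => /andP[ac cn]; rewrite trinomial; last lia.
  have dn : c - a < n.+1 by lia.
  apply: leq_trans (leq_bigmax_cond (Ordinal dn) _); last by rewrite /=; lia.
  by rewrite /= leq_mul // leq_mul // leq_central.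
apply/bigmax_leqP => d d1; set a := (n - d)./2.
have dn : d <= n by have := ltn_ord d; lia.
have := @levels_diamond_ge 'I_n a d r d1 r0; rewrite card_ord trinomial; last first.
  by rewrite /a; lia.
rewrite addKn /central => /leq_trans; apply; apply: La_ge; exact: levels_free.
Qed.

Lemma exists_maximizer lo (g : nat -> nat -> nat) :
  exists d : nat -> nat, forall n, (lo <= n) ->
    [/\ (lo <= d n <= n), (forall k, (lo <= k <= n) -> (g n k <= g n (d n)))
      & (\max_(k < n.+1 | lo <= k) g n k = g n (d n))].
Proof.
exists (fun n => [arg max_(k > (ord_max : 'I_n.+1) | lo <= k) g n k] : nat) => n ln.
rewrite (bigop.bigmax_eq_arg (ord_max : 'I_n.+1)) //; case: arg_maxnP => //= k lk kmax.
split=> //; first by rewrite lk -ltnS /=.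
by move=> j /andP[lj jn]; exact: (kmax (Ordinal (jn : (j < n.+1)))).
Qed.

(** * Copies of N: finite bounds *)

(** A form of [central n = O(2^n / sqrt n)] without roots. The even case is an induction resting on
    [(2k+1)(2k+3) <= (2k+2)^2]; the odd case follows from the next even one, whose central binomial
    is exactly twice as large. *)
Lemma central_sqr_le n : central n ^ 2 * n.+1 <= 4 ^ n.
Proof.
have odd_eq k : central k.*2.+2 = 2 * central k.*2.+1.
  have := central_S k.*2.+1; have -> : (k.*2.+1)./2 = k by lia.
  move=> e.
  apply/eqP; rewrite -(eqn_pmul2l (ltn0Sn k)) e; apply/eqP; lia.
have even_eq k : k.+1 * central k.*2.+1 = k.*2.+1 * central k.*2.
  by rewrite -central_S doubleK.
have even k : central k.*2 ^ 2 * k.*2.+1 <= 16 ^ k.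
  elim: k => [//|k IH]; rewrite doubleS odd_eq expnMn.
  rewrite -(leq_pmul2l (_ : 0 < k.+1 ^ 2)) ?expn_gt0 //.
  have -> : k.+1 ^ 2 * (2 ^ 2 * central k.*2.+1 ^ 2 * k.*2.+3)
          = (k.+1 * central k.*2.+1) ^ 2 * (4 * k.*2.+3) by rewrite expnMn; lia.
  rewrite even_eq expnMn [16 ^ k.+1]expnS.
  have -> : k.*2.+1 ^ 2 * central k.*2 ^ 2 * (4 * k.*2.+3)
          = (4 * (k.*2.+1 * k.*2.+3)) * (central k.*2 ^ 2 * k.*2.+1).
    by rewrite [k.*2.+1 ^ 2]expnS expn1; lia.
  have -> : k.+1 ^ 2 * (16 * 16 ^ k) = (16 * k.+1 ^ 2) * 16 ^ k by lia.
  by apply: leq_mul => //; lia.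
have pow k : 16 ^ k = 4 ^ k.*2 by rewrite -muln2 mulnC expnM.
rewrite -[n]odd_double_half; case: (odd n) => /=; rewrite ?add0n ?add1n.
  rewrite -(leq_pmul2l (_ : 0 < 4)) // -expnS -doubleS -pow.
  by apply: leq_trans (even n./2.+1); rewrite doubleS odd_eq expnMn; lia.
by rewrite -pow.
Qed.

Lemma bin_mul_exp_le n k x : 'C(n, k) * x ^ k <= x.+1 ^ n.
Proof.
case: (ltnP n k) => [lt|le]; first by rewrite bin_small.
rewrite -add1n expnDn.
rewrite (bigD1 (Ordinal (le : k < n.+1))) //= exp1n mul1n; exact: leq_addr.
Qed.

(** Two applications of the binomial theorem give ['C(c, c - a) 2^(c - a) <= 3^c] and
    ['C(n, c) 3^c <= 4^n], whence [8^n]. The two central factors save [sqrt ((c+1)(n-a+1))], which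
    is at least [sqrt (n+1)] as [a < c]. Everything is squared to avoid the roots. *)
Lemma N_weight_le n a c : a < c <= n ->
  ('C(n, c) * 'C(c, a) * (central c * central (n - a))) ^ 2 * n.+1 <= 64 ^ n.
Proof.
move=> /andP[ac cn].
have tri : 'C(n, c) * 'C(c, a) * (2 ^ c * 2 ^ (n - a)) <= 8 ^ n.
  have -> : 2 ^ c * 2 ^ (n - a) = 2 ^ (c - a) * 2 ^ n.
    by rewrite -!expnD; congr (_ ^ _); lia.
  rewrite -(bin_sub (ltnW ac)).
  have h1 := bin_mul_exp_le c (c - a) 2; have h2 := bin_mul_exp_le n c 3.
  rewrite (_ : 8 = 4 * 2) // expnMn !mulnA leq_mul2r; apply/orP; right.
  by apply: leq_trans h2; rewrite -mulnA leq_mul2l h1 orbT.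
have hc := central_sqr_le c; have ha := central_sqr_le (n - a).
have -> : 64 ^ n = (8 ^ n) ^ 2 by rewrite -expnM mulnC expnM.
apply: (@leq_trans (('C(n, c) * 'C(c, a)) ^ 2 *
  ((central c ^ 2 * c.+1) * (central (n - a) ^ 2 * (n - a).+1)))).
  have le : n.+1 <= c.+1 * (n - a).+1 by nia.
  rewrite [_ ^ 2 in leqLHS]expnMn -mulnA leq_mul2l expnMn mulnACA; apply/orP; right.
  by rewrite expnMn leq_mul2l le orbT.
apply: (@leq_trans (('C(n, c) * 'C(c, a)) ^ 2 * (4 ^ c * 4 ^ (n - a)))).
  by rewrite leq_mul2l leq_mul ?orbT.
have -> : 4 ^ c * 4 ^ (n - a) = (2 ^ c * 2 ^ (n - a)) ^ 2.
  by rewrite expnMn -!expnM ![_ * 2]mulnC !expnM.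
by rewrite -expnMn leq_sqr.
Qed.

Lemma La_N_upper n : La n (chain 3) posetN ^ 2 * n.+1 <= 64 ^ n.
Proof.
pose w (p : 'I_n.+1 * 'I_n.+1) :=
  'C(n, p.2) * 'C(p.2, p.1) * (central p.2 * central (n - p.1)).
have le : La n (chain 3) posetN <= \max_(p : 'I_n.+1 * 'I_n.+1 | p.1 < p.2) w p.
  apply: La_le => F F3; apply: N_bound => // a c; rewrite card_ord => /andP[ac cn].
  have an : a < n.+1 by lia.
  exact: (@leq_bigmax_cond _ _ w (Ordinal an, Ordinal (cn : c < n.+1))).
apply: (@leq_trans ((\max_(p : 'I_n.+1 * 'I_n.+1 | p.1 < p.2) w p) ^ 2 * n.+1)).
  by rewrite leq_mul2r leq_sqr le orbT.
elim/big_ind: _ => [|x y hx hy|p pp]; first by rewrite exp0n // expn_gt0.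
  by rewrite /maxn; case: ifP.
by apply: N_weight_le; rewrite pp -ltnS ltn_ord.
Qed.

Lemma bin_gt1 m k : 0 < k < m -> 1 < 'C(m, k).
Proof.
case: m k => [|m] [|k] //= km; rewrite binS.
by have h1 : 0 < 'C(m, k.+1); [|have h2 : 0 < 'C(m, k)]; rewrite ?bin_gt0; lia.
Qed.

(** Take the full levels [k] and [m]. Since [n = m + k], a set of size [m] has as many [k]-subsets
    as a set of size [k] has [m]-supersets, namely ['C(m, k)]. Excluding [b] and [c] themselves
    leaves ['C(m, k) - 1] choices for each of [a] and [d]. *)
Lemma La_N_lower n k m : 0 < k < m -> n = m + k ->
  'C(n, m) * 'C(m, k) ^ 3 <= 1024 * La n (chain 3) posetN.
Proof.
move=> km ->; set N := m + k; pose F := levels 'I_N [:: k; m].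
have F3 : copies (chain 3) F = 0 by exact: levels_free.
have bin2 := bin_gt1 km; have /andP[k0 ltkm] := km.
pose X := [set q : ({set 'I_N} * {set 'I_N}) * ({set 'I_N} * {set 'I_N}) |
  ((#|q.1.1| == m) && ((q.1.2 \subset q.1.1) && (#|q.1.2| == k))) &&
  ((q.2.1 \in below F q.1.1 :\ q.1.2) && (q.2.2 \in above F q.1.2 :\ q.1.1))].
have XN : X \subset [set q in N_quads F | uniq [:: q.2.1; q.1.2; q.1.1; q.2.2]].
  apply/subsetP => -[[c b] [a d]]; rewrite !inE /=.
  case/andP=> /andP[/eqP cm /andP[bc /eqP bk]].
  case/andP=> /and3P[ab aF ac] /and3P[dc dF bd].
  have bc' : b \proper c by rewrite properEcard bc bk cm.
  have ltac := proper_card ac; have ltbd := proper_card bd.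
  have ltbc := proper_card bc'.
  have ak : #|a| = k by case/orP: aF => /eqP // e; move: ltac; rewrite e cm ltnn.
  have dm : #|d| = m by case/orP: dF => /eqP // e; move: ltbd; rewrite e bk ltnn.
  have neq (x y : {set 'I_N}) : #|x| < #|y| -> x != y.
    by move=> lt; apply: contraTneq lt => ->; rewrite ltnn.
  rewrite cm bk aF ac dF bd bc' !eqxx orbT !inE /= !negb_or ab (eq_sym c) dc.
  by rewrite !neq ?ak ?bk ?cm ?dm.
have cardX : 'C(N, m) * ('C(m, k) * ('C(m, k).-1 * 'C(m, k).-1)) <= #|X|.
  rewrite -[X in 'C(X, m)]card_ord.
  apply: (@leq_trans (\sum_(c in [set c : {set 'I_N} | #|c| == m])
     \sum_(b in [set b : {set 'I_N} | (b \subset c) && (#|b| == k)])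
       #|setX (below F c :\ b) (above F b :\ c)|)).
    apply: sum_level_ge => c; rewrite !inE => /eqP cm; rewrite cm eqxx.
    split=> //; rewrite -{1}cm -cards_draws -sum_nat_const; apply: leq_sum => b.
    rewrite inE => /andP[bc /eqP bk].
    have bc' : b \proper c by rewrite properEcard bc bk cm.
    have h1 := @levels_below_ge _ [:: k; m] c k; have h2 := @levels_above_ge _ [:: k; m] b m.
    rewrite !inE cm eqxx in h1; rewrite !inE bk eqxx orbT card_ord addnK bin_sub ?(ltnW ltkm) // in h2.
    have := cardsD1 b (below F c); have := cardsD1 c (above F b).
    rewrite !inE bc' cm bk !eqxx !orbT /= cardsX => e1 e2.
    have g1 : 'C(m, k) <= #|below F c| := h1 isT ltkm.
    have g2 : 'C(m, k) <= #|above F b| := h2 isT ltkm.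
    by apply: leq_mul; rewrite -subn1 leq_subLR -?e1 -?e2.
  under eq_bigr do under eq_bigr do rewrite -sum1_card.
  rewrite pair_big_dep /= pair_big_dep /= -sum1_card; apply: eq_leq.
  by apply: eq_bigl => q; rewrite !inE.
have := leq_trans cardX (leq_trans (subset_leq_card XN) (N_quads_le F)).
have := La_ge posetN F3; set x := 'C(m, k) in bin2 *; set y := 'C(N, m).
set z := copies _ _; set L := La _ _ _ => zL h.
(* As [x] is at least 2, replacing [x - 1] by [x] twice costs a factor 4; with the [4 ^ 4]
   labellings per copy this makes 1024. *)
have h1 : x ^ 2 <= 4 * (x.-1 * x.-1) by rewrite expnS expn1; nia.
apply: (@leq_trans (4 * (y * (x * (x.-1 * x.-1))))).
  rewrite (_ : 4 * _ = y * (x * (4 * (x.-1 * x.-1)))); last lia.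
  by rewrite leq_mul2l expnS leq_mul2l h1 !orbT.
by apply: (@leq_trans (4 * (4 ^ 4 * L))); [rewrite leq_mul2l /=; apply: leq_trans h _ | ]; lia.
Qed.

Local Open Scope classical_set_scope.
Local Open Scope ring_scope.

(** * Location of the optimal levels *)

Lemma leq_central_self n : (n <= central n)%N.
Proof. by rewrite -{1}(bin1 n) leq_central. Qed.

Lemma leq_centralS n : (central n <= central n.+1)%N.
Proof.
by rewrite -(leq_pmul2l (ltn0Sn n./2)) central_S leq_mul2r; apply/orP; right; lia.
Qed.

Section Asymptotics.
Variable R : realType.

Lemma cvg_natrV : (fun n : nat => n%:R^-1 : R) @ \oo --> (0 : R).
Proof.
apply/gtr0_cvgV0; last exact: cvgr_idn.
by apply: filterS (nbhs_infty_gt 0) => n; rewrite ltr0n.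
Qed.

(** The recurrence makes the ratio equal to [(n+1) / (n./2 + 1)], which lies between [2 - 2/(n+1)]
    and 2. *)
Lemma cvg_central_ratio :
  (fun n => (central n.+1)%:R / (central n)%:R : R) @ \oo --> (2 : R).
Proof.
have e n : (central n.+1)%:R / (central n)%:R = n.+1%:R / (n./2.+1)%:R :> R.
  have c0 : (central n)%:R != 0 :> R by rewrite pnatr_eq0 -lt0n central_gt0.
  have := congr1 (fun k => k%:R : R) (central_S n); rewrite !natrM => h.
  have n0 : (n./2.+1)%:R != 0 :> R by rewrite pnatr_eq0.
  by apply/eqP; rewrite eqr_div // mulrC h mulrC.
apply: (@squeeze_cvgr _ _ _ _ (fun n => 2 - 2 * n.+1%:R^-1) (fun=> 2)).
- near=> n; rewrite e.
  have n0 : 0 < (n./2.+1)%:R :> R by rewrite ltr0n.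
  have n1 : 0 < n.+1%:R :> R by rewrite ltr0n.
  rewrite ler_pdivlMr // ler_pdivrMr // -natrM ler_nat; apply/andP; split; last lia.
  have -> : 2 - 2 * n.+1%:R^-1 = (2 * n)%:R / n.+1%:R :> R.
    by rewrite natrM -[X in _ = _ * X / _](addrK 1) natr1; field; rewrite gt_eqF.
  by rewrite mulrAC ler_pdivrMr // -!natrM ler_nat; nia.
- rewrite -[X in _ --> X]subr0 -[X in _ --> _ - X](mulr0 2).
  apply: cvgB; first exact: cvg_cst.
  apply: cvgM; first exact: cvg_cst.
  exact: cvg_harmonic.
- exact: cvg_cst.
Unshelve. all: by end_near. Qed.

Lemma cvg_centralV : (fun n => (central n)%:R^-1 : R) @ \oo --> (0 : R).
Proof.
apply: (@squeeze_cvgr _ _ _ _ (fun=> 0) (fun n => n%:R^-1)).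
- near=> n; rewrite invr_ge0 ler0n /= lef_pV2 ?posrE ?ltr0n ?central_gt0 //.
    by rewrite ler_nat leq_central_self.
  by near: n; exact: nbhs_infty_gt.
- exact: cvg_cst.
- exact: cvg_natrV.
Unshelve. all: by end_near. Qed.

(** The origin of the constant [2^r]: a binomial in its upper argument behaves like an [r]-th power,
    and each of its [r] factors doubles in the limit. *)
Lemma cvg_bin_central_ratio r :
  (fun n => 'C(central n.+1, r)%:R / 'C(central n, r)%:R : R) @ \oo --> (2 ^+ r : R).
Proof.
elim: r => [|r IH].
  under eq_fun do rewrite !bin0 divr1; exact: cvg_cst.
have binE m : 'C(m, r.+1)%:R = 'C(m, r)%:R * ((m - r)%:R / r.+1%:R) :> R.
  have r0 : r.+1%:R != 0 :> R by rewrite pnatr_eq0.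
  by rewrite mulrA -natrM mulnC -mul_bin_left natrM mulrAC mulfV ?mul1r.
have -> : (fun n => 'C(central n.+1, r.+1)%:R / 'C(central n, r.+1)%:R : R) =
    (fun n => ('C(central n.+1, r)%:R / 'C(central n, r)%:R) *
              ((central n.+1 - r)%:R / (central n - r)%:R)).
  have cancel (a c e f x : R) : x != 0 -> a * (c / x) * (e * (f * x)) = a * e * (c * f).
    by move=> x0; field.
  by apply/funext => n; rewrite !binE !invfM invrK cancel // pnatr_eq0.
rewrite exprSr; apply: cvgM => //.
have lim : (fun n => ((central n.+1)%:R / (central n)%:R - r%:R * (central n)%:R^-1)
    / (1 - r%:R * (central n)%:R^-1) : R) @ \oo --> ((2 - r%:R * 0) / (1 - r%:R * 0) : R).
  apply: cvgM.
    apply: cvgB; first exact: cvg_central_ratio.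
    by apply: cvgM; [exact: cvg_cst | exact: cvg_centralV].
  apply: cvgV; first by rewrite mulr0 subr0 oner_neq0.
  apply: cvgB; first exact: cvg_cst.
  by apply: cvgM; [exact: cvg_cst | exact: cvg_centralV].
rewrite mulr0 !subr0 divr1 in lim; apply: cvg_trans lim; apply: near_eq_cvg.
near=> n.
have rn : (r <= central n)%N.
  by apply: leq_trans (leq_central_self n); near: n; exact: nbhs_infty_ge.
rewrite !natrB //; last exact: leq_trans rn (leq_centralS n).
have c0 : (central n)%:R != 0 :> R by rewrite pnatr_eq0 -lt0n central_gt0.
have scale (x y z : R) : y != 0 -> (x / y - z / y) / (1 - z / y) = (x - z) / (y - z).
  move=> y0; rewrite -mulrBl (_ : 1 - z / y = (y - z) / y); last by field.
  by rewrite invfM invrK mulrACA mulVf // mulr1.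
exact: scale.
Unshelve. all: by end_near. Qed.

(** The last two hypotheses say that neither raising nor lowering [d] by one helps, so approximately
    [rho (d) (n - d) = s d]. Solving for [d / n] gives [q / (s + q)]. *)
Lemma cvg_ratio_of_balance (s : nat) (q : R) (rho : nat -> R) (d : nat -> nat) :
  (0 < s)%N -> 0 <= q -> (forall k, 0 <= rho k) -> rho @ \oo --> q ->
  (\forall n \near \oo, (d n <= n)%N) ->
  (\forall n \near \oo, (n - d n <= s * (d n).+1)%N) ->
  (\forall n \near \oo, rho (d n) * (n%:R - (d n)%:R) <= s%:R * (d n).+1%:R) ->
  (\forall n \near \oo, s%:R * (d n)%:R <= rho (d n).-1 * (n%:R - (d n)%:R + s%:R)) ->
  (fun n => (d n)%:R / n%:R) @ \oo --> q / (s%:R + q).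
Proof.
move=> s0 q0 rho0 rhoq dn H1 H2 H3.
(* If [d n] stayed bounded, [n - d n <= s * (d n).+1] would fail for large [n]. Divergence of [d] is
   what lets [rho] be replaced by its limit along [d]. *)
have dinf : d @ \oo --> \oo.
  apply/cvgnyPge => N; near=> n.
  have h : (n - d n <= s * (d n).+1)%N by near: n.
  have h' : (s * N.+1 + N <= n)%N by near: n; exact: nbhs_infty_ge.
  rewrite leqNgt; apply/negP => lt.
  have : (s * (d n).+1 <= s * N)%N by rewrite leq_mul2l lt orbT.
  by rewrite mulnS in h'; lia.
have rd : (rho \o d) @ \oo --> q by apply: cvg_comp rhoq.
have rd' : (rho \o (fun n => (d n).-1)) @ \oo --> q.
  apply: (@cvg_comp _ _ _ (fun n => (d n).-1) rho _ \oo) rhoq.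
  apply/cvgnyPge => N; move/cvgnyPge: dinf => /(_ N.+1); apply: filterS => n; lia.
have sq : s%:R + q != 0.
  by rewrite gt_eqF // ltr_wpDr // ltr0n.
pose iv n : R := n%:R^-1.
have lo : (fun n => (rho (d n) - s%:R * iv n) / (s%:R + rho (d n))) @ \oo
    --> (q - s%:R * 0) / (s%:R + q).
  apply: cvgM.
    apply: cvgB => //; apply: cvgM; [exact: cvg_cst | exact: cvg_natrV].
  apply: cvgV => //; apply: cvgD => //; exact: cvg_cst.
have hi : (fun n => (rho (d n).-1 * (1 + s%:R * iv n)) / (s%:R + rho (d n).-1)) @ \oo
    --> (q * (1 + s%:R * 0)) / (s%:R + q).
  apply: cvgM.
    apply: cvgM => //; apply: cvgD; first exact: cvg_cst.
    by apply: cvgM; [exact: cvg_cst | exact: cvg_natrV].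
  apply: cvgV => //; apply: cvgD => //; exact: cvg_cst.
rewrite mulr0 subr0 in lo; rewrite mulr0 addr0 mulr1 in hi.
apply: squeeze_cvgr lo hi; near=> n.
have n0 : 0 < n%:R :> R by rewrite ltr0n; near: n; exact: nbhs_infty_gt.
have sp : 0 < s%:R :> R by rewrite ltr0n.
have h2 : rho (d n) * (n%:R - (d n)%:R) <= s%:R * (d n).+1%:R by near: n.
have h3 : s%:R * (d n)%:R <= rho (d n).-1 * (n%:R - (d n)%:R + s%:R) by near: n.
have a0 := rho0 (d n); have b0 := rho0 (d n).-1.
rewrite /iv; move: h2 h3 a0 b0; rewrite -natr1.
move: (rho _) (rho _) => b a h2 h3 a0 b0.
have sa : 0 < s%:R + a by exact: ltr_wpDr.
have sb : 0 < s%:R + b by exact: ltr_wpDr.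
apply/andP; split.
  rewrite ler_pdivrMr // mulrAC ler_pdivlMr //.
  have -> : (a - s%:R / n%:R) * n%:R = a * n%:R - s%:R by field; rewrite gt_eqF.
  by lra.
rewrite ler_pdivrMr // mulrAC ler_pdivlMr //.
have -> : b * (1 + s%:R / n%:R) * n%:R = b * (n%:R + s%:R) by field; rewrite gt_eqF.
by lra.
Unshelve. all: by end_near. Qed.

(** The weight [W] grows from [k] to [k.+1] by the factor [e n k / k.+1], where [e n k] is about
    [(n - k) / s]. Comparing the maximizer with its two neighbours produces the balance
    inequalities, with [q = 2^r]. *)
Lemma cvg_maximizer_ratio (s lo r : nat) (W e : nat -> nat -> nat) (d : nat -> nat) :
  (0 < s)%N ->
  (forall n k, (k.+1 * W n k.+1 = e n k * W n k)%N) ->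
  (forall n k, (k <= n)%N -> (0 < W n k)%N) ->
  (forall n k, (k <= n)%N -> (n - k <= s * e n k <= n - k + s.-1)%N) ->
  (forall n, (lo <= n)%N -> (lo <= d n <= n)%N) ->
  (forall n k, (lo <= k <= n)%N ->
     (W n k * 'C(central k, r) <= W n (d n) * 'C(central (d n), r))%N) ->
  (fun n => (d n)%:R / n%:R : R) @ \oo --> (2 ^+ r / (s%:R + 2 ^+ r) : R).
Proof.
move=> s0 We W0 eP dn dmax; pose f k := 'C(central k, r).
have f0 k : (r <= k)%N -> (0 < f k)%N.
  by move=> rk; rewrite bin_gt0 (leq_trans rk) // leq_central_self.
(* The value at the competitor [k = n] is positive, hence so is the maximum and each of its
   factors. *)
have fd n : (lo <= n)%N -> (r <= n)%N -> (0 < f (d n))%N.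
  move=> ln rn; have := dmax n n; rewrite ln leqnn => /(_ isT) h.
  have : (0 < W n n * f n)%N by rewrite muln_gt0 W0 ?f0.
  by move=> /leq_trans/(_ h); rewrite muln_gt0 => /andP[].
have step n : (lo <= n)%N -> (r <= n)%N -> (d n < n)%N ->
    (e n (d n) * f (d n).+1 <= (d n).+1 * f (d n))%N.
  move=> ln rn lt; have := dmax n (d n).+1; have /andP[l1 l2] := dn n ln.
  rewrite lt (leq_trans l1) // => /(_ isT) h.
  rewrite -(leq_pmul2l (W0 n (d n) l2)).
  apply: (@leq_trans ((d n).+1 * (W n (d n).+1 * f (d n).+1))%N).
    by rewrite !mulnA [(W _ _ * e _ _)%N]mulnC -We.
  by rewrite [leqRHS]mulnCA; exact: leq_mul.
have H1 n : (lo <= n)%N -> (r <= n)%N -> (n - d n <= s * (d n).+1)%N.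
  move=> ln rn; have /andP[_ l2] := dn n ln; have /andP[e1 _] := eP n (d n) l2.
  move: l2; rewrite leq_eqVlt => /orP[/eqP->|lt]; first by rewrite subnn.
  apply: leq_trans e1 _; rewrite leq_mul2l; apply/orP; right.
  rewrite -(leq_pmul2r (fd n ln rn)); apply: leq_trans (step n ln rn lt).
  by rewrite leq_mul2l leq_bin2l ?orbT // leq_centralS.
apply: (@cvg_ratio_of_balance s _ (fun k => (f k.+1)%:R / (f k)%:R)) => //.
- exact: cvg_bin_central_ratio.
- near=> n; have ln : (lo <= n)%N by near: n; exact: nbhs_infty_ge.
  by have /andP[] := dn n ln.
- by near=> n; apply: H1; near: n; exact: nbhs_infty_ge.
- near=> n; have ln : (lo <= n)%N by near: n; exact: nbhs_infty_ge.
  have rn : (r <= n)%N by near: n; exact: nbhs_infty_ge.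
  have /andP[_ l2] := dn n ln; have /andP[e1 _] := eP n (d n) l2.
  rewrite -natrB // mulrAC ler_pdivrMr ?ltr0n ?fd // -!natrM ler_nat.
  move: l2; rewrite leq_eqVlt => /orP[/eqP en|lt].
    by rewrite {2}en subnn muln0.
  rewrite -mulnA; apply: leq_trans (leq_mul (leqnn s) (step n ln rn lt)).
  by rewrite mulnC mulnA leq_mul2r e1 orbT.
- near=> n; have ln : (lo <= n)%N by near: n; exact: nbhs_infty_ge.
  have rn : (r <= n)%N by near: n; exact: nbhs_infty_ge.
  (* This size of [n] contradicts [H1] when [d n <= lo + r]. So the lower neighbour of [d n] is
     still an admissible competitor, and its value of [f] is positive. *)
  have big : (s * (lo + r).+2 + (lo + r).+1 <= n)%N by near: n; exact: nbhs_infty_ge.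
  have dlo : (lo + r < d n)%N.
    rewrite ltnNge; apply/negP => le; have := H1 n ln rn.
    have : (s * (d n).+1 <= s * (lo + r).+1)%N by rewrite leq_mul2l ltnS le orbT.
    by rewrite mulnS in big; lia.
  have /andP[_ l2] := dn n ln.
  case: (d n) dlo l2 (dmax n (d n).-1) => //= k dlo l2.
  rewrite (_ : (lo <= k <= n)%N); last by apply/andP; split; lia.
  move=> /(_ isT) h; have kn := ltnW l2.
  have fk : (0 < f k)%N by apply: f0; lia.
  have /andP[_ e2] := eP n k kn.
  have h2 : (k.+1 * f k <= e n k * f k.+1)%N.
    rewrite -(leq_pmul2l (W0 n k kn)) [leqLHS]mulnCA.
    apply: (@leq_trans (k.+1 * (W n k.+1 * f k.+1))%N); first exact: leq_mul.
    by rewrite mulnA We -mulnA mulnCA.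
  rewrite -natrB // -natrD mulrAC ler_pdivlMr ?ltr0n // -!natrM ler_nat.
  rewrite -mulnA; apply: leq_trans (leq_mul (leqnn s) h2) _.
  by rewrite mulnA mulnC leq_mul2l; apply/orP; right; apply: leq_trans e2 _; lia.
Unshelve. all: by end_near. Qed.

Lemma equiv_of_ratio (u : nat -> R) (c : R) : 0 < c ->
  (fun n => u n / n%:R) @ \oo --> c -> u ~_\oo (fun n => c * n%:R).
Proof.
move=> c0 uc; apply/eqaddoP => eps eps0.
have ec : 0 < eps * c by exact: mulr_gt0.
near=> n; have n0 : 0 < n%:R :> R by rewrite ltr0n; near: n; exact: nbhs_infty_gt.
have : `|u n / n%:R - c| <= eps * c.
  by near: n; apply: cvgr_distC_le uc _ ec.
have -> : (u - (fun n => c * n%:R)) n = (u n / n%:R - c) * n%:R.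
  by rewrite mulrBl mulfVK ?gt_eqF.
by rewrite /= !normrM (gtr0_norm c0) (gtr0_norm n0) mulrA ler_pM2r.
Unshelve. all: by end_near. Qed.

End Asymptotics.

(** * The sequences for wedges, vees and diamonds *)

Lemma wedge_vee_extremal (R : realType) (r : nat) : (1 <= r)%N ->
    exists i : nat -> int,
      ((fun n : nat => (i n)%:~R : R) ~_\oo
         (fun n : nat => 2 ^+ r / (2 ^+ r + 1) * n%:R : R)) /\
      forall n : nat,
        La n (chain 3) (wedge r) = La n (chain 3) (vee r) /\
        La n (chain 3) (vee r) =
          (binz n (i n) * 'C(binz (i n) (i n %/ 2)%Z, r))%N.
Proof.
move=> r0.
have [d dP] := exists_maximizer 1 (fun n k => 'C(n, k) * 'C(central k, r))%N.
(* For [n = 0] no level [k >= 1] exists and the extremal number is 0; the index -1 makes [binz]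
   vanish, whereas the index 0 would give 1 when [r = 1]. *)
exists (fun n => if n is 0 then -1 else (d n)%:Z); split; last first.
  move=> n; split; first by rewrite La_vee.
  rewrite La_vee La_wedge //; case: n => [|n].
    by rewrite big_pred0 // => k; case: k => -[].
  by have [_ _ ->] := dP n.+1 isT; rewrite divz_nat divn2.
apply: equiv_of_ratio.
  by rewrite divr_gt0 ?addr_gt0 ?exprn_gt0 ?ltr0n ?ltr01.
have lim : (fun n => (d n)%:R / n%:R : R) @ \oo --> (2 ^+ r / (1%:R + 2 ^+ r) : R).
  apply: (@cvg_maximizer_ratio R 1 1 r (fun n k => 'C(n, k)) (fun n k => n - k)%N) => //.
  - by move=> n k; rewrite mul_bin_left.
  - by move=> n k; rewrite bin_gt0.
  - by move=> n k _; rewrite mul1n addn0 leqnn.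
  - by move=> n /dP[].
  - move=> n k /andP[k1 kn]; have [_ h _] := dP n (leq_trans k1 kn).
    by apply: h; rewrite k1.
rewrite addrC; apply: cvg_trans lim; apply: near_eq_cvg.
by apply: filterS (nbhs_infty_gt 0) => -[].
Qed.

Lemma diamond_extremal (R : realType) (r : nat) : (1 <= r)%N ->
    exists i j : nat -> int,
      [/\ (fun n : nat => (i n)%:~R : R) ~_\oo
            (fun n : nat => n%:R / (2 ^+ r + 2) : R),
          forall n : nat, j n = n%:Z - i n \/ j n = n%:Z - i n - 1
        & forall n : nat,
            La n (chain 4) (diamond r) =
              (binz n (j n) * binz (j n) (i n) *
               'C(binz (j n - i n) ((j n - i n) %/ 2)%Z, r))%N].
Proof.
move=> r0.
have [d dP] := exists_maximizer 2
  (fun n k => 'C(n, k) * central (n - k) * 'C(central k, r))%N.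
(* The maximizer [d] is the gap between the outer levels, and [i] centres it: [n - i - d] equals [i]
   or [i + 1] according to the parity of [n - d]. *)
pose i n := (n - d n)./2.
(* Below [n = 2] there is no room for a gap of 2 and the extremal number is 0. The values [i = -1]
   and [j = n + 1] satisfy [j = n - i] and make the first binomial vanish. *)
exists (fun n => if (n < 2)%N then -1 else (i n)%:Z).
exists (fun n => if (n < 2)%N then n%:Z + 1 else (i n + d n)%N%:Z); split.
- have lim : (fun n => (d n)%:R / n%:R : R) @ \oo --> (2 ^+ r / (2%:R + 2 ^+ r) : R).
    (* Raising [k] multiplies ['C(n, k)] by [(n - k) / (k + 1)] and roughly halves
       [central (n - k)], leaving [uphalf (n - k) / (k + 1)]; hence [s = 2]. *)
    apply: (@cvg_maximizer_ratio R 2 2 r (fun n k => 'C(n, k) * central (n - k))%N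
              (fun n k => uphalf (n - k))) => //.
    + move=> n k; case: (ltnP k n) => [lt|le].
        have -> : (n - k = (n - k.+1).+1)%N by lia.
        have := mul_bin_left n k; have := central_S (n - k.+1).
        have -> : (n - k = (n - k.+1).+1)%N by lia.
        by move=> /= h1 h2; rewrite mulnA h2 mulnAC -h1; lia.
      by rewrite bin_small // (eqP (le : n - k == 0)%N) muln0.
    + by move=> n k kn; rewrite muln_gt0 bin_gt0 kn central_gt0.
    + by move=> n k _; lia.
    + by move=> n /dP[].
    + move=> n k /andP[k1 kn]; have [_ h _] := dP n (leq_trans k1 kn).
      by apply: h; rewrite k1.
  have p0 : 0 < 2 ^+ r :> R by rewrite exprn_gt0.
  rewrite (_ : (fun n : nat => n%:R / (2 ^+ r + 2)) = (fun n => (2 ^+ r + 2)^-1 * n%:R));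
    last by apply/funext => n; rewrite mulrC.
  apply: equiv_of_ratio; first by rewrite invr_gt0 addr_gt0.
  have half : (fun n => (1 - (d n)%:R / n%:R) / 2 : R) @ \oo --> ((2 ^+ r + 2)^-1 : R).
    have -> : (2 ^+ r + 2)^-1 = (1 - 2 ^+ r / (2 + 2 ^+ r)) / 2 :> R.
      by field; rewrite ?gt_eqF // ?addr_gt0.
    by apply: cvgM; [apply: cvgB => //; exact: cvg_cst | exact: cvg_cst].
  have half' : (fun n => (1 - (d n)%:R / n%:R) / 2 - n%:R^-1 : R) @ \oo
      --> ((2 ^+ r + 2)^-1 : R).
    by rewrite -[X in _ --> X]subr0; apply: cvgB => //; exact: cvg_natrV.
  apply: squeeze_cvgr half' half; near=> n.
  have n2 : (1 < n)%N by near: n; exact: nbhs_infty_gt.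
  have n0 : 0 < n%:R :> R by rewrite ltr0n ltnW.
  rewrite ltnNge n2 /= ler_pdivrMr // ler_pdivlMr //.
  have [/andP[_ dn] _ _] := dP n n2.
  have -> : ((1 - (d n)%:R / n%:R) / 2 - n%:R^-1) * n%:R = (n%:R - (d n)%:R) / 2 - 1 :> R.
    by field; rewrite gt_eqF.
  have -> : (1 - (d n)%:R / n%:R) / 2 * n%:R = (n%:R - (d n)%:R) / 2 :> R.
    by field; rewrite gt_eqF.
  rewrite -natrB // -pmulrn /i; have e := odd_double_half (n - d n).
  have := congr1 (fun k => k%:R : R) e; rewrite natrD -muln2 natrM => h.
  have : (odd (n - d n))%:R <= 1 :> R by case: odd; rewrite ?ler01.
  have : 0 <= (odd (n - d n))%:R :> R by [].
  by move=> *; apply/andP; split; lra.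
- move=> n; case: ltnP => n2; first by left; lia.
  have [/andP[_ dn] _ _] := dP n n2; rewrite /i; lia.
move=> n; rewrite La_diamond //; case: ltnP => n2.
  rewrite big1 => [|k k1]; last by have := ltn_ord k; lia.
  by case: n n2 => [|[]].
have [/andP[d2 dn] _ ->] := dP n n2.
have -> : (i n + d n)%N%:Z - (i n)%:Z = (d n)%:Z by lia.
rewrite divz_nat divn2 /=; congr (_ * _)%N.
by rewrite trinomial ?addKn // /i; lia.
Unshelve. all: by end_near. Qed.

(** * Copies of N: growth rate *)

Section NGrowth.
Variable R : realType.
Implicit Types x c : R.

Lemma cubic_root_unique x y :
  0 = 7 * x ^+ 3 - 10 * x ^+ 2 + 5 * x - 1 ->
  0 = 7 * y ^+ 3 - 10 * y ^+ 2 + 5 * y - 1 -> x = y.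
Proof.
move=> ex ey; apply/eqP; rewrite -subr_eq0.
have : (x - y) * (7 * (x ^+ 2 + x * y + y ^+ 2) - 10 * (x + y) + 5) = 0 by lra.
move/eqP; rewrite mulf_eq0 => /orP[//|/eqP e].
(* The cofactor is positive: 84 times it equals [(21(x+y) - 20)^2 + 147(x-y)^2 + 20]. *)
have : 0 <= (21 * (x + y) - 20) ^+ 2 by exact: sqr_ge0.
have : 0 <= (x - y) ^+ 2 by exact: sqr_ge0.
by lra.
Qed.

Lemma cubic_root_exists : exists2 c0 : R,
  699 / 10 ^+ 3 + 222 / 10 ^+ 6 <= c0 <= 699 / 10 ^+ 3 + 223 / 10 ^+ 6
  & 0 = 7 * c0 ^+ 3 - 10 * c0 ^+ 2 + 5 * c0 - 1.
Proof.
pose p : {poly R} := 7%:P * 'X^3 - 10%:P * 'X^2 + 5%:P * 'X - 1%:P.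
have pE x : p.[x] = 7 * x ^+ 3 - 10 * x ^+ 2 + 5 * x - 1 by rewrite !hornerE.
have [||c0 c0P] := @poly_ivt R p (699 / 10 ^+ 3 + 222 / 10 ^+ 6)
  (699 / 10 ^+ 3 + 223 / 10 ^+ 6); first lra.
  by rewrite !pE; apply/andP; split; lra.
by rewrite rootE pE => /eqP e; exists c0.
Qed.

Let ln2_gt0 : 0 < ln (2 : R). Proof. by rewrite ln_gt0 ?ltr1n. Qed.

(* With [X = c0 / (1 - c0)^2], the two chains say [1 <= (2 (X/8)^20)^9 (X/8)]
   and [(2 (X/8)^20)^(13^2) <= 2], that is [3 - 9/181 <= log2 X <= 3 - 42/845]. *)
Lemma growth_rate_bounds c0 :
  699 / 10 ^+ 3 + 222 / 10 ^+ 6 <= c0 <= 699 / 10 ^+ 3 + 223 / 10 ^+ 6 ->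
  2 + 95 / 10 ^+ 2 + 2 / 10 ^+ 4 <= (ln c0 - 2 * ln (1 - c0)) / ln 2
    < 2 + 95 / 10 ^+ 2 + 3 / 10 ^+ 4.
Proof.
move=> /andP[lo hi]; have c00 : 0 < c0 by lra.
have d0 : 0 < 1 - c0 by lra.
have d2 : 0 < (1 - c0) ^+ 2 by exact: exprn_gt0.
have lnX : ln c0 - 2 * ln (1 - c0) = ln (c0 / (1 - c0) ^+ 2).
  by rewrite ln_div ?posrE // lnXn // mulr2n; ring.
have ln_le (u v : R) : 0 < u -> u <= v -> ln u <= ln v.
  by move=> u0 uv; rewrite ler_ln ?posrE // (lt_le_trans u0).
have X0 : 0 < c0 / (1 - c0) ^+ 2 by exact: divr_gt0.
rewrite lnX; move: X0; set X := c0 / _ => X0.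
have Xlo : 966 / 10 ^+ 3 + 124 / 10 ^+ 6 <= X / 8.
  rewrite /X mulrAC ler_pdivlMr //.
  have : (1 - c0) ^+ 2 <= (1 - (699 / 10 ^+ 3 + 222 / 10 ^+ 6)) ^+ 2.
    by rewrite ler_sqr ?nnegrE; lra.
  by lra.
have Xhi : X / 8 <= 966 / 10 ^+ 3 + 133 / 10 ^+ 6.
  rewrite /X mulrAC ler_pdivrMr //.
  have : (1 - (699 / 10 ^+ 3 + 223 / 10 ^+ 6)) ^+ 2 <= (1 - c0) ^+ 2.
    by rewrite ler_sqr ?nnegrE; lra.
  by lra.
have lnX8 : ln (X / 8) = ln X - 3 * ln 2.
  have -> : 8 = 2 ^+ 3 :> R by ring.
  by rewrite ln_div ?posrE ?exprn_gt0 // lnXn // mulr_natl.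
rewrite ler_pdivlMr // ltr_pdivrMr //; apply/andP; split.
  pose y : R := 966 / 10 ^+ 3 + 124 / 10 ^+ 6.
  (* [z] is [2 y^20] rounded down. Rounding between the powers replaces one comparison with a large
     exponent by several with small ones. *)
  pose z : R := 1 + 3 / 10 ^+ 3 + 892 / 10 ^+ 6.
  have y0 : 0 < y by rewrite /y; lra.
  have z0 : 0 < z by rewrite /z; lra.
  have h1 : ln z <= ln 2 + 20 * ln y.
    apply: le_trans (ln_le _ (2 * y ^+ 20) z0 _) _; first by rewrite /z /y; lra.
    by rewrite lnM ?posrE ?exprn_gt0 // lnXn // mulr_natl.
  have h2 : 0 <= 9 * ln z + ln y.
    apply: le_trans (_ : ln (z ^+ 9 * y) <= _).
      by rewrite ln_ge0 // /z /y; lra.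
    by rewrite lnM ?posrE ?exprn_gt0 // lnXn // mulr_natl.
  have h3 : ln y <= ln X - 3 * ln 2 by rewrite -lnX8; exact: ln_le.
  by have := ln2_gt0; lra.
pose y : R := 966 / 10 ^+ 3 + 133 / 10 ^+ 6.
(* Here the rounding goes up: [z] bounds [2 y^20], [w] bounds [z^13], and [w^13 <= 2]. *)
pose z : R := 1 + 4 / 10 ^+ 3 + 81 / 10 ^+ 6.
pose w : R := 1 + 54 / 10 ^+ 3 + 372 / 10 ^+ 6.
have y0 : 0 < y by rewrite /y; lra.
have z0 : 0 < z by rewrite /z; lra.
have w0 : 0 < w by rewrite /w; lra.
have h1 : ln 2 + 20 * ln y <= ln z.
  rewrite mulr_natl -lnXn // -lnM ?posrE ?exprn_gt0 //; apply: ln_le.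
    by rewrite mulr_gt0 ?exprn_gt0.
  by rewrite /z /y; lra.
have h2 : 13 * ln z <= ln w.
  by rewrite mulr_natl -lnXn //; apply: ln_le; rewrite ?exprn_gt0 // /z /w; lra.
have h3 : 13 * ln w <= ln 2.
  by rewrite mulr_natl -lnXn //; apply: ln_le; rewrite ?exprn_gt0 // /w; lra.
have h4 : ln X - 3 * ln 2 <= ln y.
  by rewrite -lnX8; apply: ln_le Xhi; rewrite divr_gt0.
by have := ln2_gt0; lra.
Qed.

Definition N_rate x :=
  2 * x * ln x - 4 * (1 - x) * ln (1 - x) - 3 * (2 * x - 1) * ln (2 * x - 1).

(** With [m = x n] and [k = (1 - x) n], the term [h(x)] is the exponent of ['C(n, m)] and
    [x h((1-x)/x)] that of ['C(m, k)], which occurs cubed. The range of [x] keeps all logarithms at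
    positive arguments. *)
Lemma entropy_N_rate x : 1 / 2 < x < 1 ->
  entropy x + 3 * x * entropy ((1 - x) / x) = N_rate x / ln 2.
Proof.
move=> /andP[x1 x2]; have x0 : 0 < x by lra.
have y0 : 0 < 1 - x by lra.
have z0 : 0 < 2 * x - 1 by lra.
rewrite /entropy /log2.
have -> : 1 - (1 - x) / x = (2 * x - 1) / x by field; rewrite gt_eqF.
by rewrite !ln_div ?posrE // /N_rate; field; rewrite !gt_eqF.
Qed.

(** The cubic is [(2x-1)^3 - x(1-x)^2] expanded, which expresses that the derivative of [N_rate]
    vanishes. Taking logarithms eliminates [ln (2 c0 - 1)]. *)
Lemma N_rate_at_root c0 : 1 / 2 < c0 < 1 ->
  0 = 7 * c0 ^+ 3 - 10 * c0 ^+ 2 + 5 * c0 - 1 ->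
  N_rate c0 = ln c0 - 2 * ln (1 - c0).
Proof.
move=> /andP[x1 x2] e; have x0 : 0 < c0 by lra.
have y0 : 0 < 1 - c0 by lra.
have z0 : 0 < 2 * c0 - 1 by lra.
have : ln (c0 * (1 - c0) ^+ 2) = ln ((2 * c0 - 1) ^+ 3) by congr ln; lra.
rewrite lnM ?posrE ?exprn_gt0 // !lnXn // => h.
have h' : 3 * ln (2 * c0 - 1) = ln c0 + 2 * ln (1 - c0).
  by rewrite (mulr_natl (ln _) 3) -h (mulr_natl (ln _) 2).
rewrite /N_rate (_ : 3 * _ * _ = (2 * c0 - 1) * (3 * ln (2 * c0 - 1))); last by ring.
by rewrite h'; ring.
Qed.

(** Stirling up to a logarithmic error, by induction; the increments are compared through
    [ln (1 + t) <= t] at [t = 1/k] and [t = -1/(k+1)]. The case [n = 0] relies on the convention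
    [ln 0 = 0]. *)
Lemma ln_fact_bounds (n : nat) :
  n%:R * ln n%:R - n%:R <= ln (n`!%:R : R)
    <= n%:R * ln n%:R - n%:R + (1 + ln n%:R).
Proof.
elim: n => [|n /andP[lo hi]]; first by rewrite ln0 // ln1; lra.
have f0 : 0 < n`!%:R :> R by rewrite ltr0n fact_gt0.
have m0 : 0 < n.+1%:R :> R by [].
rewrite factS natrM lnM ?posrE //.
case: n => [|n] in lo hi f0 m0 *; first by rewrite fact0 ln1; lra.
set k := n.+1 in lo hi f0 m0 *; have k0 : 0 < k%:R :> R by [].
have e1 : k.+1%:R = k%:R + 1 :> R by rewrite natr1.
have h1 : k%:R * (ln k.+1%:R - ln k%:R) <= 1 :> R.
  rewrite -ln_div ?posrE // -ler_pdivlMl // mulr1.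
  have -> : k.+1%:R / k%:R = 1 + k%:R^-1 :> R by rewrite e1; field; rewrite gt_eqF.
  by apply: le_ln1Dx; apply: lt_trans (_ : 0 < _); rewrite ?invr_gt0 // ltrN10.
have h2 : 1 <= k.+1%:R * (ln k.+1%:R - ln k%:R) :> R.
  rewrite -ler_pdivrMl // mulr1 -[leLHS]opprK lerNl opprB -ln_div ?posrE //.
  have -> : k%:R / k.+1%:R = 1 + - k.+1%:R^-1 :> R.
    by rewrite e1; field; rewrite -e1 gt_eqF.
  by apply: le_ln1Dx; rewrite ltrN2 invf_lt1 // ltr1n.
move: h1 h2 lo hi; rewrite e1; move: (ln _) (ln _) (ln _) => a b c h1 h2 lo hi.
by apply/andP; split; lra.
Qed.

(** The error [7 (1 + ln n)] comes from the upper Stirling bounds on the seven factorials in the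
    denominator of ['C(n, m) 'C(m, k)^3 = n! m!^2 / (k!^4 l!^3)]. *)
Lemma ln_La_N_lower (n m : nat) : (n < m + m)%N -> (m < n)%N ->
  n%:R * N_rate (m%:R / n%:R) - (7 * (1 + ln n%:R) + ln 1024)
    <= ln ((La n (chain 3) posetN)%:R : R).
Proof.
move=> nm mn; pose k := (n - m)%N; pose l := (m - k)%N.
have [k0 km nE mE] : [/\ (0 < k)%N, (k < m)%N, n = (m + k)%N & m = (k + l)%N].
  by rewrite /l /k; split; lia.
have l0 : (0 < l)%N by lia.
have lnk : ln k%:R <= ln n%:R :> R.
  by rewrite ler_ln ?posrE ?ltr0n ?ler_nat //; lia.
have lnl : ln l%:R <= ln n%:R :> R.
  by rewrite ler_ln ?posrE ?ltr0n ?ler_nat //; lia.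
have n0 : 0 < n%:R :> R by rewrite ltr0n; lia.
have m0 : 0 < m%:R :> R by rewrite ltr0n; lia.
have binP : (0 < 'C(n, m) * 'C(m, k) ^ 3)%N.
  by rewrite muln_gt0 expn_gt0 !bin_gt0; lia.
have := @La_N_lower n k m; rewrite k0 => /(_ km nE).
set P := ('C(n, m) * _)%N in binP *; set L := La _ _ _ => le.
have L0 : (0 < L)%N by move: (leq_trans binP le); rewrite muln_gt0 => /andP[].
have Pfact : (P * (k`! ^ 4 * l`! ^ 3) = n`! * m`! ^ 2)%N.
  have h1 := bin_fact (ltnW mn); have h2 := bin_fact (ltnW km).
  rewrite -/k in h1; rewrite -/l in h2.
  by rewrite /P -h1 -h2; move: 'C(n, m) 'C(m, k) (k`!) (l`!) => *; ring.
clearbody P; have pos (j : nat) : 0 < j`!%:R :> R by rewrite ltr0n fact_gt0.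
have lnP : ln P%:R + 4 * ln k`!%:R + 3 * ln l`!%:R = ln n`!%:R + 2 * ln m`!%:R :> R.
  have := congr1 (fun j => ln (j%:R : R)) Pfact.
  rewrite (natrM _ P) (natrM _ (k`! ^ 4)) (natrM _ n`!) !natrX.
  rewrite !lnM ?posrE ?mulr_gt0 ?exprn_gt0 // ?ltr0n //.
  by lra.
have lnL : ln P%:R <= ln 1024 + ln L%:R :> R.
  rewrite -lnM ?posrE ?ltr0n // -natrM ler_ln ?posrE ?ltr0n ?muln_gt0 ?L0 //.
  by rewrite ler_nat.
have /andP[n1 _] := ln_fact_bounds n; have /andP[m1 _] := ln_fact_bounds m.
have /andP[_ k1] := ln_fact_bounds k; have /andP[_ l1] := ln_fact_bounds l.
have k0' : 0 < k%:R :> R by rewrite ltr0n.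
have l0' : 0 < l%:R :> R by rewrite ltr0n.
have nR : n%:R = m%:R + k%:R :> R by rewrite -natrD -nE.
have mR : m%:R = k%:R + l%:R :> R by rewrite -natrD -mE.
(* After dividing by [n] inside the logarithms, the [ln n] terms and the linear terms cancel because
   [n + 2m = 4k + 3l]. *)
suff -> : n%:R * N_rate (m%:R / n%:R) =
    (n%:R * ln n%:R - n%:R) + 2 * (m%:R * ln m%:R - m%:R)
    - 4 * (k%:R * ln k%:R - k%:R) - 3 * (l%:R * ln l%:R - l%:R) by lra.
rewrite /N_rate.
have -> : 1 - m%:R / n%:R = k%:R / n%:R :> R by rewrite nR; field; rewrite -nR gt_eqF.
have -> : 2 * (m%:R / n%:R) - 1 = l%:R / n%:R :> R.
  by rewrite nR {1}mR [in X in _ / X]mR mR; field; rewrite -mR -nR gt_eqF.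
rewrite !ln_div ?posrE //; move: (ln _) (ln _) (ln _) (ln _) => a b c d.
by rewrite nR mR; field; rewrite -mR -nR gt_eqF.
Qed.

(** Writing [ln n = 2 ln (sqrt n) <= 2 sqrt n] bounds the quotient by [2 / sqrt n]. *)
Lemma cvg_ln_div_n : (fun n : nat => ln n%:R / n%:R : R) @ \oo --> (0 : R).
Proof.
have sqrtV : (fun n : nat => 2 * Num.sqrt (n%:R^-1) : R) @ \oo --> 2 * Num.sqrt (0 : R).
  apply: cvgM; first exact: cvg_cst.
  by apply: continuous_cvg; [exact: sqrt_continuous | exact: cvg_natrV].
rewrite sqrtr0 mulr0 in sqrtV.
apply: squeeze_cvgr (cvg_cst _) sqrtV; near=> n.
have n0 : 0 < n%:R :> R by rewrite ltr0n; near: n; exact: nbhs_infty_gt.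
have s0 : 0 < Num.sqrt n%:R :> R by rewrite sqrtr_gt0.
have n1 : 1 <= n%:R :> R by rewrite ler1n -(ltr0n R).
rewrite divr_ge0 ?ln_ge0 //=.
rewrite (sqrtrV (ltW n0)); move: s0 (sqr_sqrtr (ltW n0)).
move: (Num.sqrt _) => s s0 <-; rewrite lnXn // ler_pdivrMr ?exprn_gt0 //.
have -> : 2 / s * s ^+ 2 = 2 * s by field; rewrite gt_eqF.
by rewrite -[leLHS]mulr_natl ler_pM2l // ltW // ln_sublinear.
Unshelve. all: by end_near. Qed.

Lemma N_rate_continuous x : 1 / 2 < x < 1 -> {for x, continuous N_rate}.
Proof.
move=> /andP[x1 x2]; rewrite /continuous_at /N_rate.
have lnc (f : R -> R) : f @ x --> f x -> 0 < f x -> (fun y => ln (f y)) @ x --> ln (f x).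
  by move=> fx f0; apply: (continuous_cvg _ (continuous_ln f0)).
have c2 : (fun y : R => 2 * y) @ x --> 2 * x by apply: cvgM; [exact: cvg_cst | exact: cvg_id].
have c1 : (fun y : R => 1 - y) @ x --> 1 - x by apply: cvgB; [exact: cvg_cst | exact: cvg_id].
have c3 : (fun y : R => 2 * y - 1) @ x --> 2 * x - 1 by apply: cvgB => //; exact: cvg_cst.
apply: cvgB; first apply: cvgB.
- by apply: cvgM => //; apply: (lnc id); [exact: cvg_id | lra].
- apply: cvgM; first by apply: cvgM => //; exact: cvg_cst.
  by apply: lnc => //; lra.
- apply: cvgM; first by apply: cvgM => //; exact: cvg_cst.
  by apply: lnc => //; lra.
Qed.

Lemma La_N_lower_asymptotic c0 : 1 / 2 < c0 < 1 ->
  exists eps : nat -> R, (eps @ \oo --> (0 : R)) /\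
    \forall n \near \oo,
      2 `^ ((N_rate c0 / ln 2 + eps n) * n%:R) <= (La n (chain 3) posetN)%:R.
Proof.
move=> /andP[x1 x2]; pose m n := Num.truncn (c0 * n%:R).
have mP n : c0 * n%:R - 1 <= (m n)%:R <= c0 * n%:R.
  have c0n : 0 <= c0 * n%:R by rewrite mulr_ge0 //; lra.
  have /andP[-> lt] := truncn_itv c0n.
  by move: lt; rewrite -natr1 => /ltW; rewrite andbT lerBlDr.
have mc : (fun n => (m n)%:R / n%:R) @ \oo --> c0.
  have lo : (fun n : nat => c0 - n%:R^-1) @ \oo --> c0.
    by rewrite -[X in _ --> X]subr0; apply: cvgB; [exact: cvg_cst | exact: cvg_natrV].
  apply: squeeze_cvgr lo (cvg_cst c0); near=> n.
  have n0 : 0 < n%:R :> R by rewrite ltr0n; near: n; exact: nbhs_infty_gt.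
  have /andP[a b] := mP n; rewrite ler_pdivlMr // ler_pdivrMr // b andbT.
  by rewrite mulrBl mulVf // gt_eqF.
pose err n : R := 7 * (1 + ln n%:R) + ln 1024.
(* The first term is the error from rounding [c0 n] down to the integer [m n], controlled by
   continuity; the second is the Stirling error per [n]. With this choice the required bound is an
   identity. *)
pose eps n := (N_rate ((m n)%:R / n%:R) - N_rate c0) / ln 2 - err n / n%:R / ln 2.
exists eps; split.
  rewrite -[X in _ --> X]subr0 /eps; apply: cvgB.
    rewrite -[X in _ --> X](mul0r (ln 2)^-1) -[X in X * _](subrr (N_rate c0)).
    apply: cvgM; last exact: cvg_cst.
    apply: cvgB; last exact: cvg_cst.
    apply: continuous_cvg mc; apply: N_rate_continuous; exact/andP.
  rewrite -[X in _ --> X](mul0r (ln 2)^-1); apply: cvgM; last exact: cvg_cst.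
  have -> : (fun n => err n / n%:R) =
      (fun n : nat => 7 * (ln n%:R / n%:R) + (7 + ln 1024) * n%:R^-1).
    by apply/funext => n; rewrite /err; ring.
  have lim0 : 0 = 7 * 0 + (7 + ln 1024) * 0 :> R by rewrite !mulr0 addr0.
  rewrite [X in _ --> X]lim0.
  apply: cvgD; apply: cvgM; try exact: cvg_cst; [exact: cvg_ln_div_n | exact: cvg_natrV].
near=> n.
have n0 : 0 < n%:R :> R by rewrite ltr0n; near: n; exact: nbhs_infty_gt.
have mlo : 1 / 2 < (m n)%:R / n%:R :> R by near: n; apply: cvgr_gt mc _ _.
have mhi : (m n)%:R / n%:R < 1 :> R by near: n; apply: cvgr_lt mc _ _.
have mn : (m n < n)%N by move: mhi; rewrite ltr_pdivrMr // mul1r ltr_nat.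
have nm : (n < m n + m n)%N.
  by move: mlo; rewrite ltr_pdivlMr // -(ltr_nat R) natrD; lra.
have h := ln_La_N_lower nm mn.
have L0 : (0 < La n (chain 3) posetN)%N.
  have km : (0 < n - m n < m n)%N by lia.
  have nE : n = (m n + (n - m n))%N by lia.
  have binP : (0 < 'C(n, m n) * 'C(m n, n - m n) ^ 3)%N.
    by rewrite muln_gt0 expn_gt0 !bin_gt0; lia.
  by have := leq_trans binP (La_N_lower km nE); rewrite muln_gt0 => /andP[].
rewrite -ler_ln ?posrE ?ltr0n ?powR_gt0 // ln_powR.
apply: le_trans h; rewrite le_eqVlt; apply/orP; left; apply/eqP.
by rewrite /eps -/(err n); field; rewrite !gt_eqF.
Unshelve. all: by end_near. Qed.

Lemma La_N_upper_asymptotic :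
  (fun n : nat => (La n (chain 3) posetN)%:R : R) =o_\oo
     (fun n : nat => 2 ^+ (3 * n) : R).
Proof.
apply/eqoP => eps eps0; near=> n.
have n0 : 0 < n.+1%:R :> R by [].
have e : n.+1%:R^-1 <= eps ^+ 2.
  near: n; apply: (cvgr_le (0 : R)); first exact: cvg_harmonic.
  exact: exprn_gt0.
rewrite normr_nat ger0_norm ?exprn_ge0 //.
(* Squaring matches the form of [La_N_upper], where the saved factor [1/(n+1)] is eventually at most
   [eps^2]. *)
rewrite -ler_sqr ?nnegrE ?mulr_ge0 ?exprn_ge0 ?(ltW eps0) //.
have := La_N_upper n; rewrite -(ler_nat R) natrM !natrX => h.
have -> : (eps * 2 ^+ (3 * n)) ^+ 2 = eps ^+ 2 * 64 ^+ n :> R.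
  have e64 : 2 ^+ 6 = 64 :> R by ring.
  by rewrite exprMn -exprM (_ : (3 * n * 2 = 6 * n)%N) ?exprM ?e64 //; lia.
apply: (@le_trans _ _ (n.+1%:R^-1 * 64 ^+ n)); last first.
  by rewrite ler_pM2r // exprn_gt0.
by rewrite ler_pdivlMl // mulrC.
Unshelve. all: by end_near. Qed.

End NGrowth.

Theorem theorem1p4 (R : realType) :
  (forall r : nat, (1 <= r)%N ->
    exists i : nat -> int,
      ((fun n : nat => (i n)%:~R : R) ~_\oo
         (fun n : nat => 2 ^+ r / (2 ^+ r + 1) * n%:R : R)) /\
      forall n : nat,
        La n (chain 3) (wedge r) = La n (chain 3) (vee r) /\
        La n (chain 3) (vee r) =
          (binz n (i n) * 'C(binz (i n) (i n %/ 2)%Z, r))%N) /\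
  (forall r : nat, (1 <= r)%N ->
    exists i j : nat -> int,
      [/\ (fun n : nat => (i n)%:~R : R) ~_\oo
            (fun n : nat => n%:R / (2 ^+ r + 2) : R),
          forall n : nat, j n = n%:Z - i n \/ j n = n%:Z - i n - 1
        & forall n : nat,
            La n (chain 4) (diamond r) =
              (binz n (j n) * binz (j n) (i n) *
               'C(binz (j n - i n) ((j n - i n) %/ 2)%Z, r))%N]) /\
  (exists c0 : R,
    (forall x : R, 0 = 7 * x ^+ 3 - 10 * x ^+ 2 + 5 * x - 1 <-> x = c0) /\
    let c := entropy c0 + 3 * c0 * entropy ((1 - c0) / c0) in
    [/\ 2 + 95 / 10 ^+ 2 + 2 / 10 ^+ 4 <= c < 2 + 95 / 10 ^+ 2 + 3 / 10 ^+ 4,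
        exists eps : nat -> R, (eps @ \oo --> (0 : R)) /\
          \forall n \near \oo,
            2 `^ ((c + eps n) * n%:R) <= (La n (chain 3) posetN)%:R
      & (fun n : nat => (La n (chain 3) posetN)%:R : R) =o_\oo
          (fun n : nat => 2 ^+ (3 * n) : R)]).
Proof.
split; first exact: wedge_vee_extremal.
split; first exact: diamond_extremal.
have [c0 c0P e] := cubic_root_exists R.
have c01 : 1 / 2 < c0 < 1 by move: c0P => /andP[? ?]; apply/andP; split; lra.
exists c0; split.
  move=> x; split=> [ex|->]; last exact: e.
  exact: cubic_root_unique ex e.
rewrite /= entropy_N_rate //; split.
- by rewrite N_rate_at_root //; exact: growth_rate_bounds.
- exact: La_N_lower_asymptotic.
- exact: La_N_upper_asymptotic.
Qed.
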